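(* For all nonnegative integers $d$ and positive integers $k$ there is a number $B(d,k)$, depending only on $d$ and $k$, such that the following holds: for every $n \geq 0$ and every $n$-dimensional lattice polytope $P \subset \mathbb{R}^n$ whose $h^*$-polynomial $h^*_P(t)$ has degree $d$ and leading coefficient $h^*_d = k$, one has $\operatorname{Vol}(P) \leq B(d,k)$. (In particular the bound is independent of the dimension $n$.)
   Context: A lattice polytope $P\subset\mathbb{R}^n$ is the convex hull of finitely many points of $\mathbb{Z}^n$; here $P$ is assumed $n$-dimensional. For nonnegative integers $m$ let $f_P(m)=|mP\cap\mathbb{Z}^n|$. The Ehrhart series can be written as $\sum_{m\ge0} f_P(m)t^m = h^*_P(t)/(1-t)^{n+1}$ for a polynomial $h^*_P(t)=h^*_0+h^*_1t+\dots+h^*_dt^d$ of degree $d\le n$ with $h^*_d\neq 0$; $d$ is called the degree of $P$. $\operatorname{Vol}(P)$ denotes the normalized volume, i.e. $n!$ times the Euclidean volume; it equals $h^*_0+\dots+h^*_d$. *)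

(* Defs.v *)
From HB Require Import structures.
From mathcomp Require Import all_boot all_order all_algebra.
From mathcomp Require Import boolp reals.
Set Implicit Arguments. Unset Strict Implicit. Unset Printing Implicit Defensive.
Import Order.TTheory GRing.Theory Num.Theory.
Local Open Scope ring_scope.

(* A lattice polytope P in R^n is given as the convex hull of a finite list
   V of points of Z^n (row vectors with integer entries). *)

Section Ehrhart.
Variable R : realType.

Definition in_dilate (n : nat) (V : seq 'rV[int]_n) (m : nat) (x : 'rV[int]_n) : Prop :=
  exists lam : 'I_(size V) -> R,
    (forall i, 0 <= lam i) /\
    \sum_(i < size V) lam i = m%:R /\
    forall j : 'I_n, (x ord0 j)%:~R = \sum_(i < size V) lam i * ((nth 0 V i) ord0 j)%:~R.

Definition coord_bound (n : nat) (V : seq 'rV[int]_n) : nat :=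
  \max_(v <- V) \max_(j < n) `|v ord0 j|%N.

Definition box_point (n M : nat) (c : {ffun 'I_n -> 'I_(M.*2.+1)}) : 'rV[int]_n :=
  \row_(j < n) ((c j : nat)%:Z - M%:Z).

(* f_P(m) = |mP ∩ Z^n|.  Every lattice point of mP has all coordinates of
   absolute value <= m * coord_bound V, so it suffices to count inside that
   box (box_point is injective). *)
Definition ehrhart (n : nat) (V : seq 'rV[int]_n) (m : nat) : nat :=
  #|[set c : {ffun 'I_n -> 'I_((m * coord_bound V).*2.+1)} |
      `[< in_dilate V m (box_point c) >] ]|.

Definition full_dim (n : nat) (V : seq 'rV[int]_n) : Prop :=
  V != [::] /\
  \rank (\matrix_(i < size V, j < n)
           (((nth 0 V i) ord0 j - (nth 0 V 0) ord0 j)%:~R : R)) = n.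

(* Coefficient of t^i in h*_P(t) = (1 - t)^(n+1) * sum_m f_P(m) t^m. *)
Definition hstar (n : nat) (V : seq 'rV[int]_n) (i : nat) : int :=
  \sum_(j < i.+1) (-1) ^+ j * ('C(n.+1, j))%:Z * (ehrhart V (i - j))%:Z.

Definition hstar_deg_lead (n : nat) (V : seq 'rV[int]_n) (d : nat) (k : int) : Prop :=
  hstar V d = k /\ k != 0 /\ forall i, (d < i)%N -> hstar V i = 0.

(* vol is the normalized volume n! * Vol_euclid(P), where the Euclidean
   volume is the Jordan content lim_{m -> oo} |P ∩ (1/m)Z^n| / m^n
   = lim_{m -> oo} f_P(m) / m^n. *)
Definition is_norm_volume (n : nat) (V : seq 'rV[int]_n) (vol : R) : Prop :=
  forall eps : R, 0 < eps -> exists M : nat, forall m : nat, (M <= m)%N ->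
    `| (n`!)%:R * (ehrhart V m)%:R / (m%:R ^+ n) - vol | < eps.

End Ehrhart.

(* Main.v *)
Require Import Defs.
From HB Require Import structures.
From mathcomp Require Import all_boot all_order all_algebra.
From mathcomp Require Import boolp reals.
From mathcomp Require Import ring lra zify.
Set Implicit Arguments. Unset Strict Implicit. Unset Printing Implicit Defensive.
Import Order.TTheory GRing.Theory Num.Theory.
Local Open Scope ring_scope.

(** Let [a_i = (1, v_i)], let [C] be the cone they span, and let [r = n + 1 - d].
    The cells of a generic regular triangulation of [C], made half-open by a generic
    direction [q], partition the lattice points of [C]; hence [h*_i] counts the box
    points of height [i], and reversing [q] shows that no interior lattice point of [C]
    has height below [r], while exactly [k] of them, among them some [x], have height [r].

    - Every simplex and every circuit of the [a_i] inherits the bound [r] on the heights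
      of interior lattice points.  Together with Caratheodory's theorem this yields a basis
      [S] and [B] in [S] with [S \ B] bounded in terms of [d], along which [P] is a Cayley
      sum.  Replacing the vertices [a_i], [i] in [B], by other points of their Cayley
      factors turns [x] into new interior points of height [r], so only boundedly many
      factors are nontrivial, and all others are apices of lattice pyramids.
    - If [x] had a very small but positive coordinate in some simplex, Dirichlet's theorem
      would give more than [k] points [x + l (j x - sum_i c_i a_i)], [l <= k], that are
      interior of height [r].  Hence [x - a_v / L] is interior for all [v], with [L]
      depending on [d] and [k] only.
    - Consequently lattice points of [C] at height [h] with zero apex coordinates that are
      congruent modulo [L (h + 1)] produce distinct points [x + (z - z') / (L (h + 1))]:
      there are at most [k] of them in a class.  Box points have zero apex coordinates, so
      all [h*_i] are bounded, and so is their sum [Vol P]. *)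

(** * Cones and bases *)

Lemma fin_small (R : realFieldType) (T : finType) (P : T -> R -> Prop) :
  (forall t e e', 0 < e' -> e' <= e -> P t e -> P t e') ->
  (forall t, exists e, 0 < e /\ P t e) ->
  exists e, 0 < e /\ forall t, P t e.
Proof.
move=> Pmono /choice [f Hf].
have f0 t : 0 < f t by case: (Hf t).
suff [e [e0 He]] : exists e, 0 < e /\ forall t, t \in enum T -> e <= f t.
  exists e; split=> // t; have [_] := Hf t; apply: Pmono => //.
  by apply: He; rewrite mem_enum.
elim: (enum T) => [|t s [e [e0 He]]]; first by exists 1.
exists (Num.min e (f t)); split; first by rewrite lt_min e0 f0.
move=> u; rewrite inE => /orP [/eqP ->|us]; rewrite ge_min ?lexx ?orbT //.
by rewrite He.
Qed.

Definition supp (R : realFieldType) N (l : 'rV[R]_N) := [set i | l 0 i != 0].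

Section Cone.
Variables (R : realType) (N p : nat) (A : 'M[R]_(N, p)).
Implicit Types (y z u v c : 'rV[R]_p) (S : {set 'I_N}) (X : 'M[R]_(p, N)).

Definition cone z := exists l : 'rV[R]_N, (forall i, 0 <= l 0 i) /\ z = l *m A.

Lemma cone0 : cone 0.
Proof. by exists 0; split=> [i|]; rewrite ?mxE ?mul0mx. Qed.

Lemma coneD y z : cone y -> cone z -> cone (y + z).
Proof.
move=> [l [l0 ->]] [m [m0 ->]]; exists (l + m); split; last by rewrite mulmxDl.
by move=> i; rewrite mxE addr_ge0.
Qed.

Lemma coneZ t z : 0 <= t -> cone z -> cone (t *: z).
Proof.
move=> t0 [l [l0 ->]]; exists (t *: l); split; last by rewrite scalemxAl.
by move=> i; rewrite mxE mulr_ge0.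
Qed.

Lemma cone_row i : cone (row i A).
Proof.
by exists (delta_mx 0 i); split=> [j|]; rewrite ?rowE // mxE ler0n.
Qed.

Lemma cone_sum (I : finType) (P : pred I) (F : I -> 'rV[R]_p) :
  (forall i, P i -> cone (F i)) -> cone (\sum_(i | P i) F i).
Proof.
move=> HF; elim/big_rec: _ => [|i z Pi Hz]; first exact: cone0.
by apply: coneD => //; apply: HF.
Qed.

(** The feasible directions at [y]; for a polyhedral cone and a point [y] in it, this is the usual
    tangent cone. *)
Definition tangent_cone y u := exists2 e : R, 0 < e & cone (y + e *: u).

(** Convexity: the shorter step is a convex combination of [y] and the longer one. *)
Lemma tangent_cone_le y u e e' : cone y -> cone (y + e *: u) -> 0 <= e' -> e' <= e ->
  cone (y + e' *: u).
Proof.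
move=> Cy Ce e'0 e'e.
have [e0|e0] := ltP 0 e; last first.
  have -> : e' = 0 by apply: le_anti; rewrite e'0 (le_trans e'e).
  by rewrite scale0r addr0.
have -> : y + e' *: u = (1 - e' / e) *: y + (e' / e) *: (y + e *: u).
  rewrite scalerDr scalerA divfK ?gt_eqF // addrA -scalerDl subrK scale1r //.
apply: coneD; apply: coneZ => //; last by rewrite divr_ge0 // ltW.
by rewrite subr_ge0 ler_pdivrMr // mul1r.
Qed.

Lemma tangent_coneD y u v : cone y -> tangent_cone y u -> tangent_cone y v -> tangent_cone y (u + v).
Proof.
move=> Cy [e e0 Ce] [f f0 Cf].
exists (Num.min e f / 2); first by rewrite divr_gt0 // lt_min e0.
have -> : y + (Num.min e f / 2) *: (u + v) =
  2^-1 *: ((y + Num.min e f *: u) + (y + Num.min e f *: v)).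
  by apply/rowP => j; rewrite !mxE; field.
apply: coneZ; first by rewrite invr_ge0.
have m0 : 0 <= Num.min e f by rewrite le_min !ltW.
apply: coneD.
  by apply: tangent_cone_le Ce _ _ => //; rewrite ge_min lexx.
by apply: tangent_cone_le Cf _ _ => //; rewrite ge_min lexx orbT.
Qed.

Lemma tangent_coneZ y u t : cone y -> 0 <= t -> tangent_cone y u -> tangent_cone y (t *: u).
Proof.
move=> Cy; rewrite le_eqVlt => /orP [/eqP <-|t0] [e e0 Ce].
  by exists 1 => //; rewrite scale0r scaler0 addr0.
exists (e / t); first by rewrite divr_gt0.
by rewrite scalerA divfK // gt_eqF.
Qed.

Lemma tangent_cone_sum y (I : finType) (P : pred I) (F : I -> 'rV[R]_p) : cone y ->
  (forall i, P i -> tangent_cone y (F i)) -> tangent_cone y (\sum_(i | P i) F i).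
Proof.
move=> Cy HF; elim/big_rec: _ => [|i z Pi Hz].
  by exists 1 => //; rewrite scaler0 addr0.
by apply: tangent_coneD => //; apply: HF.
Qed.

Lemma tangent_cone_cone y u : cone y -> cone u -> tangent_cone y u.
Proof. by move=> Cy Cu; exists 1 => //; rewrite scale1r; apply: coneD. Qed.

Lemma tangent_cone_sub y u : cone (y - u) -> tangent_cone y (- u).
Proof. by exists 1 => //; rewrite scale1r. Qed.

Lemma tangent_cone_add2 y c u v : cone y -> cone c -> tangent_cone y u -> tangent_cone c v ->
  tangent_cone (y + c) (u + v).
Proof.
move=> Cy Cc [e e0 Ce] [f f0 Cf].
exists (Num.min e f); first by rewrite lt_min e0.
have m0 : 0 <= Num.min e f by rewrite le_min !ltW.
rewrite scalerDr addrACA; apply: coneD.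
  by apply: tangent_cone_le Ce _ _ => //; rewrite ge_min lexx.
by apply: tangent_cone_le Cf _ _ => //; rewrite ge_min lexx orbT.
Qed.

(* The interior of the cone, described by tangent directions instead of a topology. *)
Definition interior_cone z := forall u, tangent_cone z u.

Lemma interior_cone_cone z : interior_cone z -> cone z.
Proof. by move=> /(_ 0) [e _]; rewrite scaler0 addr0. Qed.

Lemma interior_coneD z c : interior_cone z -> cone c -> interior_cone (z + c).
Proof.
move=> Iz Cc u; have [e e0 Ce] := Iz u; exists e => //.
by rewrite addrAC; apply: coneD.
Qed.

Lemma interior_coneZ t z : 0 < t -> interior_cone z -> interior_cone (t *: z).
Proof.
move=> t0 Iz u; have [e e0 Ce] := Iz u; exists (t * e); first exact: mulr_gt0.
by rewrite -scalerA -scalerDr; apply: coneZ => //; apply: ltW.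
Qed.

(* [X] maps a vector to its coordinates in the basis [S], padded with zeros. *)
Definition is_basis S X := [/\ X *m A = 1%:M, (forall i, i \notin S -> forall j, X j i = 0)
  & forall s, s \in S -> row s A *m X = delta_mx 0 s].

Definition coord X z (i : 'I_N) : R := (z *m X) 0 i.

Lemma coord0 X i : coord X 0 i = 0.
Proof. by rewrite /coord mul0mx mxE. Qed.
Lemma coordD X y z i : coord X (y + z) i = coord X y i + coord X z i.
Proof. by rewrite /coord mulmxDl mxE. Qed.
Lemma coordZ X t z i : coord X (t *: z) i = t * coord X z i.
Proof. by rewrite /coord -scalemxAl mxE. Qed.
Lemma coordN X z i : coord X (- z) i = - coord X z i.
Proof. by rewrite /coord mulNmx mxE. Qed.
Lemma coordB X y z i : coord X (y - z) i = coord X y i - coord X z i.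
Proof. by rewrite coordD coordN. Qed.
Lemma coord_sum X (I : finType) (P : pred I) (F : I -> 'rV[R]_p) i :
  coord X (\sum_(j | P j) F j) i = \sum_(j | P j) coord X (F j) i.
Proof. by rewrite /coord mulmx_suml summxE. Qed.
Definition coordE := (coord0, coordD, coordZ, coordN).

Section Basis.
Variables (S : {set 'I_N}) (X : 'M[R]_(p, N)).
Hypothesis BS : is_basis S X.

Lemma coord_out z i : i \notin S -> coord X z i = 0.
Proof.
case: BS => _ H _ iS; rewrite /coord mxE big1 // => j _.
by rewrite H // mulr0.
Qed.

Lemma coord_expand z : z = \sum_(s in S) coord X z s *: row s A.
Proof.
have [H _ _] := BS; rewrite -[LHS]mulmx1 -H mulmxA mulmx_sum_row.
rewrite [RHS]big_mkcond /=; apply: eq_bigr => s _.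
case: ifPn => // sS; rewrite -[_ 0 s]/(coord X z s) coord_out //.
by rewrite scale0r.
Qed.

Lemma coord_row s t : s \in S -> coord X (row s A) t = (s == t)%:R.
Proof. by case: BS => _ _ H sS; rewrite /coord H // mxE eqxx eq_sym. Qed.

Lemma coord_comb (P : pred 'I_N) (f : 'I_N -> R) t : (forall s, P s -> s \in S) ->
  coord X (\sum_(s | P s) f s *: row s A) t = if P t then f t else 0.
Proof.
move=> PS; rewrite coord_sum; case: ifPn => [Pt|Pt].
  rewrite (bigD1 t) //= coordZ coord_row ?PS // eqxx mulr1 big1 ?addr0 // => s.
  by case/andP => Ps st; rewrite coordZ coord_row ?PS // (negPf st) mulr0.
rewrite big1 // => s Ps; rewrite coordZ coord_row ?PS //.
by case: eqP => [e|]; rewrite ?mulr0 //; move: Pt; rewrite -e Ps.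
Qed.

Lemma coord_mulmx l s : supp l \subset S -> s \in S -> coord X (l *m A) s = l 0 s.
Proof.
move=> lS sS; rewrite mulmx_sum_row (bigID (mem S)) /= [X in _ + X]big1 ?addr0.
  by rewrite coord_comb // sS.
move=> i; apply: contraNeq => li; apply: (subsetP lS); rewrite inE.
by apply: contraNneq li => ->; rewrite scale0r.
Qed.

Lemma cone_coord z : (forall s, s \in S -> 0 <= coord X z s) -> cone z.
Proof.
move=> H; rewrite [z]coord_expand; apply: cone_sum => s sS.
by apply: coneZ; [exact: H | exact: cone_row].
Qed.

(* The directions [u] are split as [(u + t W) + (- t W)] with [t] so large that
   [u + t W] has nonnegative coordinates on [B]. *)
Lemma interior_cone_shift y c W (B : {set 'I_N}) : cone y -> cone c ->
  (forall s, s \in S -> s \notin B -> tangent_cone y (- row s A)) ->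
  tangent_cone c (- W) -> (forall s, s \in S -> s \in B -> 0 < coord X W s) -> interior_cone (y + c).
Proof.
move=> Cy Cc Hy Hc HW u.
pose t := \sum_(s in S :&: B) `|coord X u s| / coord X W s.
have t0 : 0 <= t.
  by apply: sumr_ge0 => s; rewrite inE => /andP [sS sB]; rewrite divr_ge0 // ltW // HW.
have -> : u = (u + t *: W) + t *: (- W) by rewrite scalerN addrK.
apply: tangent_cone_add2 => //; last exact: tangent_coneZ.
rewrite [u + _]coord_expand; apply: tangent_cone_sum => // s sS.
have [sB|sB] := boolP (s \in B).
  apply: tangent_coneZ => //; last by apply: tangent_cone_cone => //; exact: cone_row.
  have Ws := HW s sS sB.
  have : `|coord X u s| <= t * coord X W s.
    rewrite -ler_pdivrMr // /t (bigD1 s) ?inE ?sS //= lerDl.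
    apply: sumr_ge0 => r; rewrite inE => /andP [] /andP [rS rB] _.
    by rewrite divr_ge0 // ltW // HW.
  rewrite coordD coordZ; have := ler_norm (- coord X u s); rewrite normrN; lra.
have [c0|c0] := leP 0 (coord X (u + t *: W) s).
  by apply: tangent_coneZ => //; apply: tangent_cone_cone => //; exact: cone_row.
rewrite -[coord _ _ _]opprK scaleNr -scalerN; apply: tangent_coneZ => //; last exact: Hy.
by rewrite oppr_ge0 ltW.
Qed.

Lemma interior_cone_coord z : (forall s, s \in S -> 0 < coord X z s) -> interior_cone z.
Proof.
move=> H; rewrite -[z]addr0.
apply: (@interior_cone_shift _ _ 0 set0) => //; last by move=> s; rewrite inE.
- by apply: cone_coord => s sS; apply: ltW; apply: H.
- exact: cone0.
- move=> s sS _; exists (coord X z s); first exact: H.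
  apply: cone_coord => t tS; rewrite scalerN coordB coordZ coord_row //.
  have := H t tS; case: eqP => [->|_]; rewrite ?mulr1 ?subrr // mulr0 subr0.
  by move/ltW.
- by rewrite oppr0; apply: tangent_cone_cone; exact: cone0.
Qed.

(** Gauss-Jordan pivot: a component along [row s A] is rewritten through [row i A] and the remaining
    basis rows, which is a rank-one update of [X]. *)
Lemma basis_pivot i s : s \in S -> i \notin S -> coord X (row i A) s != 0 ->
  exists X', is_basis (i |: (S :\ s)) X'.
Proof.
move=> sS iS cis; have [HX HX0 HXS] := BS.
set cc := coord X (row i A) s in cis.
exists (X + col s X *m (cc^-1 *: (delta_mx 0 i - row i A *m X))); split.
- rewrite mulmxDl HX -mulmxA -scalemxAl mulmxBl -mulmxA HX mulmx1 -rowE subrr.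
  by rewrite scaler0 mulmx0 addr0.
- move=> j; rewrite !inE negb_or negb_and negbK => /andP [ji js] k.
  rewrite mxE (mxE _ _ k j) big_ord1 !mxE eqxx (negPf ji) /=.
  case/orP: js => [/eqP ->|jS].
    have -> : \sum_j0 row i A 0 j0 * X j0 s = cc by rewrite /cc /coord mxE.
    by rewrite sub0r mulrN mulVf // mulrN1 subrr.
  rewrite HX0 // big1 ?subrr ?mulr0 ?addr0 // => j0 _.
  by rewrite HX0 // mulr0.
- move=> t; rewrite mulmxDr mulmxA.
  have -> : row t A *m col s X = (coord X (row t A) s)%:M.
    by apply/matrixP => a b; rewrite !ord1 /coord !mxE eqxx mulr1n; apply: eq_bigr => ? _; rewrite !mxE.
  rewrite mul_scalar_mx scalerA !inE => /orP [/eqP ->|/andP [ts tS]].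
    by rewrite -/cc divff // scale1r addrC subrK.
  by rewrite coord_row // (negPf ts) mul0r scale0r addr0 HXS.
Qed.

(** Compare traces: [X *m A] is the identity, and the diagonal of [A *m X] is the indicator of
    [S]. *)
Lemma card_basis : #|S| = p.
Proof.
have [HX HX0 HXS] := BS.
apply/eqP; rewrite -(eqr_nat R); apply/eqP.
have <- : \tr (A *m X) = p%:R by rewrite mxtrace_mulC HX mxtrace1.
rewrite /mxtrace -sum1_card natr_sum big_mkcond /=; apply: eq_bigr => s _.
have -> : (A *m X) s s = coord X (row s A) s.
  by rewrite /coord -row_mul [RHS]mxE.
by case: ifPn => sS; [rewrite coord_row // eqxx | rewrite coord_out].
Qed.

End Basis.

(** * Independent rows and Caratheodory's theorem *)

Definition indep (F : {set 'I_N}) := forall m : 'rV[R]_N,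
  (forall i, i \notin F -> m 0 i = 0) -> m *m A = 0 -> m = 0.

(** Steinitz exchange: a row of [F] outside [S] has a nonzero coordinate at some [s] outside [F],
    else it would depend on other rows of [F]; pivoting there shrinks [F :\: S]. *)
Lemma indep_extend F S0 X0 : is_basis S0 X0 -> indep F ->
  exists S X, is_basis S X /\ F \subset S.
Proof.
move=> B0 iF.
suff H : forall m S X, is_basis S X -> #|F :\: S| = m ->
  exists S X, is_basis S X /\ F \subset S by apply: H B0 _.
elim=> [|m IH] S X BS e.
  exists S, X; split=> //; apply/subsetP => i iF'.
  by move/eqP: e; rewrite cards_eq0 => /eqP/setP/(_ i); rewrite !inE iF' andbT => /negbFE.
have [i] : exists i, i \in F :\: S by apply/set0Pn; rewrite -card_gt0 e.
rewrite inE => /andP [iS iFi].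
have [s] : exists s, [&& s \in S, s \notin F & coord X (row i A) s != 0].
  apply/existsP; apply: contraT; rewrite negb_exists => /forallP H.
  have : delta_mx 0 i - row i A *m X = 0.
    apply: iF; last by case: BS => HX _ _; rewrite mulmxBl -mulmxA HX mulmx1 -rowE subrr.
    move=> j jF; rewrite 2!mxE [X in _ + X]mxE -[X in _ - X]/(coord X (row i A) j).
    rewrite (_ : j == i = false) ?andbF ?sub0r; last by apply: contraNF jF => /eqP ->.
    have [jS|jS] := boolP (j \in S); last by rewrite (coord_out BS) ?oppr0.
    by have := H j; rewrite jS jF /= negbK => /eqP ->; rewrite oppr0.
  move/rowP/(_ i); rewrite 2!mxE [X in _ + X]mxE [RHS]mxE !eqxx.
  rewrite -[X in _ - X]/(coord X (row i A) i).
  by rewrite (coord_out BS) // subr0 => /eqP; rewrite oner_eq0.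
case/and3P => sS sF cs.
have [X' B'] := basis_pivot BS sS iS cs.
apply: (IH _ _ B'); apply/eqP; rewrite -eqSS -e.
have -> : F :\: S = i |: (F :\: (i |: S :\ s)).
  apply/setP => j; rewrite !inE; case: (eqVneq j i) => [->|ji] /=; first by rewrite iS iFi.
  by case: (eqVneq j s) => [->|js] //=; rewrite (negPf sF) ?andbF.
by rewrite cardsU1 !inE eqxx.
Qed.

End Cone.

(* One step of Caratheodory's reduction. *)
Lemma conic_move (R : realFieldType) N (l m : 'rV[R]_N) :
  (forall i, 0 <= l 0 i) -> (forall i, l 0 i = 0 -> m 0 i = 0) ->
  (exists i, m 0 i < 0) ->
  exists t : R, [/\ 0 < t, forall i, 0 <= (l + t *: m) 0 i &
    supp (l + t *: m) \proper supp l].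
Proof.
move=> l0 lm [i0 mi0].
(* Ratio test: [i] is the first coordinate to reach zero along [m], so the step stops there and
   loses [i] from the support. *)
pose i := [arg min_(i < i0 | m 0 i < 0) (l 0 i / - m 0 i)]%O.
have [mi Hi] : m 0 i < 0 /\ forall j, m 0 j < 0 -> l 0 i / - m 0 i <= l 0 j / - m 0 j.
  by rewrite /i; case: Order.TotalTheory.arg_minP.
have li : 0 < l 0 i.
  rewrite lt_neqAle l0 andbT eq_sym; apply/eqP => e.
  by move: mi; rewrite lm // ltxx.
have nm : 0 < - m 0 i by rewrite oppr_gt0.
exists (l 0 i / - m 0 i); split; first by rewrite divr_gt0.
  move=> j; rewrite !mxE; have [mj|mj] := ltP (m 0 j) 0; last first.
    by rewrite addr_ge0 // mulr_ge0 // ltW // divr_gt0.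
  have := Hi j mj; rewrite ler_pdivlMr ?oppr_gt0 //; lra.
apply/properP; split.
  apply/subsetP => j; rewrite !inE !mxE; apply: contraNneq => e.
  by rewrite e (lm _ e) mulr0 addr0.
exists i; first by rewrite inE gt_eqF.
rewrite inE !mxE negbK.
by rewrite invrN mulrN mulNr divfK ?subrr // lt_eqF.
Qed.

Lemma not_indepP (R : realType) N p (A : 'M[R]_(N, p)) (F : {set 'I_N}) :
  ~ indep A F -> exists m : 'rV[R]_N,
    [/\ forall i, i \notin F -> m 0 i = 0, m *m A = 0 & m != 0].
Proof.
move=> H; apply: contrapT => H'; apply: H => m m1 m2; apply/eqP/negPn/negP => m0.
by apply: H'; exists m.
Qed.

(** Induction on the support size: as long as the support is dependent, moving along a dependency,
    with its sign chosen to have a negative entry, shrinks it. *)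
Lemma caratheodory (R : realType) N p (A : 'M[R]_(N, p)) z : cone A z ->
  exists l : 'rV[R]_N, [/\ forall i, 0 <= l 0 i, z = l *m A & indep A (supp l)].
Proof.
case=> l [l0 ->]; have [k] := ubnP #|supp l|.
elim: k => // k IH in l l0 *; rewrite ltnS => lk.
have [|/not_indepP [m [ms mA mn]]] := pselect (indep A (supp l)); first by exists l.
have {}ms i : l 0 i = 0 -> m 0 i = 0 by move=> e; apply: ms; rewrite inE e eqxx.
have [m' [m's m'A m'neg]] : exists m' : 'rV_N, [/\ forall i, l 0 i = 0 -> m' 0 i = 0,
    m' *m A = 0 & exists i, m' 0 i < 0].
  have /rV0Pn [i mi] := mn.
  case: (ltP (m 0 i) 0) => [mneg|mpos]; first by exists m; split=> //; exists i.
  exists (- m); split; first by move=> j /ms e; rewrite mxE e oppr0.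
    by rewrite mulNmx mA oppr0.
  by exists i; rewrite mxE oppr_lt0 lt_neqAle eq_sym mi.
have [t [t0 lt0 lsub]] := conic_move l0 m's m'neg.
have [|l' [l'0 e iA]] := IH (l + t *: m') lt0.
  exact: leq_trans (proper_card lsub) lk.
by exists l'; split=> //; rewrite -e mulmxDl -scalemxAl m'A scaler0 addr0.
Qed.

(** The reduction can keep [v] in the support: all rows have height 1, so the entries of a
    dependency sum to zero and both signs have a negative entry. The sign can thus be chosen so that
    the weight of [v] does not decrease. *)
Lemma caratheodory_pos (R : realType) N n (A : 'M[R]_(N, n.+1)) (l : 'rV[R]_N) v :
  (forall i, A i 0 = 1) -> (forall i, 0 <= l 0 i) -> 0 < l 0 v ->
  exists l' : 'rV[R]_N,
    [/\ forall i, 0 <= l' 0 i, l *m A = l' *m A, 0 < l' 0 v & indep A (supp l')].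
Proof.
move=> A1 l0 lv; have [k] := ubnP #|supp l|.
elim: k => // k IH in l l0 lv *; rewrite ltnS => lk.
have [|/not_indepP [m [ms mA mn]]] := pselect (indep A (supp l)); first by exists l.
have {}ms i : l 0 i = 0 -> m 0 i = 0 by move=> e; apply: ms; rewrite inE e eqxx.
have neg (m' : 'rV[R]_N) : m' *m A = 0 -> m' != 0 -> exists i, m' 0 i < 0.
  move=> m'A; apply: contraPP => H; apply/negP; rewrite negbK.
  have m'0 i : 0 <= m' 0 i by rewrite leNgt; apply/negP => Hi; apply: H; exists i.
  have /eqP : \sum_i m' 0 i = 0.
    move/rowP/(_ 0): m'A; rewrite !mxE => e; rewrite -[RHS]e.
    by apply: eq_bigr => i _; rewrite A1 mulr1.
  rewrite psumr_eq0 // => /allP H'; apply/eqP/rowP => i; rewrite mxE; apply/eqP.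
  by apply: H'; rewrite mem_index_enum.
have [m' [m's m'A m'v [i mi]]] : exists m' : 'rV_N, [/\ forall i, l 0 i = 0 -> m' 0 i = 0,
    m' *m A = 0, 0 <= m' 0 v & exists i, m' 0 i < 0].
  case: (leP 0 (m 0 v)) => mv; first by exists m; split=> //; apply: neg.
  exists (- m); split; first by move=> j /ms e; rewrite mxE e oppr0.
  - by rewrite mulNmx mA oppr0.
  - by rewrite mxE oppr_ge0 ltW.
  - by apply: neg; rewrite ?mulNmx ?mA ?oppr0 // oppr_eq0.
have [t [t0 lt0 lsub]] := conic_move l0 m's (ex_intro _ i mi).
have [||l' [l'0 e l'v iA]] := IH (l + t *: m') lt0.
- by rewrite !mxE ltr_pwDl // mulr_ge0 // ltW.
- exact: leq_trans (proper_card lsub) lk.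
by exists l'; split=> //; rewrite -e mulmxDl -scalemxAl m'A scaler0 addr0.
Qed.

(** Take [w] on the moment curve [(1, s, s^2, ...)]: each condition excludes the roots of a nonzero
    polynomial in [s], and some positive integer avoids them all. *)
Lemma generic_moment (R : realFieldType) N (T : finType) (c : T -> 'rV[R]_N) :
  (forall t, c t != 0) ->
  exists w : 'rV[R]_N, (forall i, 0 < w 0 i) /\ forall t, \sum_i c t 0 i * w 0 i != 0.
Proof.
move=> cn; pose P t : {poly R} := \poly_(i < N) (\sum_(j < N | j == i :> nat) c t 0 j).
have PE t x : (P t).[x] = \sum_i c t 0 i * x ^+ i.
  rewrite horner_poly; apply: eq_bigr => i _; congr (_ * _).
  by rewrite (big_pred1 i).
have Pn t : P t != 0.
  have /rV0Pn [i ci] := cn t; apply: contraNneq ci => /polyP/(_ i).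
  by rewrite coef_poly ltn_ord coef0 (big_pred1 i) // => ->.
pose Q := \prod_t P t.
have Qn : Q != 0 by apply/prodf_neq0 => t _.
have [s s0 Qs] : exists2 s : R, 0 < s & ~~ root Q s.
  apply: contrapT => H.
  have : (size [seq i.+1%:R : R | i <- iota 0 (size Q)] < size Q)%N.
    apply: max_poly_roots => //; last first.
      by rewrite map_inj_uniq ?iota_uniq // => i j /eqP; rewrite eqr_nat => /eqP [].
    apply/allP => _ /mapP [i _ ->]; apply: contrapT => /negP Hi; apply: H.
    by exists i.+1%:R; rewrite ?ltr0n.
  by rewrite size_map size_iota ltnn.
exists (\row_i s ^+ i); split=> [i|t]; first by rewrite mxE exprn_gt0.
have := Qs; rewrite /root horner_prod => /prodf_neq0/(_ t isT); rewrite PE.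
by under [X in _ -> X != 0]eq_bigr => i _ do rewrite mxE.
Qed.

(** * The half-open triangulation and box points *)

Section Triangulation.
Variables (R : realType) (N n : nat) (A : 'M[R]_(N, n.+1)).
Hypothesis A1 : forall i, A i 0 = 1.
Implicit Types (y z u : 'rV[R]_n.+1) (S : {set 'I_N}).

Lemma coord_height S X z : is_basis A S X -> \sum_(s in S) coord X z s = z 0 0.
Proof.
move=> BS; rewrite [in RHS](coord_expand BS z) summxE; apply: eq_bigr => s _.
by rewrite !mxE A1 mulr1.
Qed.

Lemma cone_height z : cone A z -> 0 <= z 0 0.
Proof.
by case=> l [l0 ->]; rewrite mxE sumr_ge0 // => i _; rewrite A1 mulr1.
Qed.

Definition basisb S := `[< exists X, is_basis A S X >].
(** A choice of coordinate matrix depending on [S] alone, with dummy value 0 when [S] is not a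
    basis. *)
Definition coordmx S : 'M[R]_(n.+1, N) :=
  if pselect (exists X, is_basis A S X) is left H then sval (cid H) else 0.

Lemma coordmxP S : basisb S -> is_basis A S (coordmx S).
Proof. by rewrite /basisb /coordmx => /asboolP H; case: pselect => // H'; case: cid. Qed.

Lemma basisbE S X : is_basis A S X -> basisb S.
Proof. by move=> H; apply/asboolP; exists X. Qed.

Variable w : 'rV[R]_N.

(* [dual S] is the linear form equal to [w i] on [row i A], [i \in S]; a cell is a basis
   that is optimal for the linear program [min w l] over [l *m A = z], [0 <= l]. *)
Definition dual S z := \sum_(s in S) coord (coordmx S) z s * w 0 s.

(** Genericity of the lifting heights [w]: no further lifted row lies on the hyperplane through a
    lifted basis, so the regular subdivision is a triangulation. *)
Hypothesis wgen : forall S i, basisb S -> i \notin S -> dual S (row i A) != w 0 i.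

Definition cell S := basisb S && [forall i, dual S (row i A) <= w 0 i].

Lemma dual_in S i : basisb S -> i \in S -> dual S (row i A) = w 0 i.
Proof.
move=> /coordmxP BS iS; rewrite /dual (bigD1 i) //= (coord_row BS) // eqxx mul1r big1 ?addr0 //.
by move=> j /andP [jS ji]; rewrite (coord_row BS) // eq_sym (negPf ji) mul0r.
Qed.

Lemma dual_expand S S' z : basisb S' ->
  dual S z = \sum_(t in S') coord (coordmx S') z t * dual S (row t A).
Proof.
move=> /coordmxP BS'; rewrite {1}[z](coord_expand BS') /dual.
under eq_bigr => s _ do rewrite coord_sum mulr_suml.
rewrite exchange_big /=; apply: eq_bigr => t _; rewrite mulr_sumr.
by apply: eq_bigr => s _; rewrite coordZ mulrA.
Qed.

(** For a cell [T], the form [dual T] is below [w] on all rows and strictly below off [T]. If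
    neither cell contained the other, [dual S y] and [dual S' y] would each be smaller than the
    other. *)
Lemma cell_uniq y S S' : cell S -> cell S' ->
  (forall s, s \in S -> 0 < coord (coordmx S) y s) ->
  (forall s, s \in S' -> 0 < coord (coordmx S') y s) -> S = S'.
Proof.
have lt T T' : cell T -> cell T' -> (forall s, s \in T' -> 0 < coord (coordmx T') y s) ->
    ~~ (T' \subset T) -> dual T y < dual T' y.
  move=> /andP [bT /forallP oT] /andP [bT' _] pT' /subsetPn [t tT' tT].
  rewrite (dual_expand T y bT') /dual (bigD1 t) //= [ltRHS](bigD1 t) //=.
  apply: ltr_leD; first by rewrite ltr_pM2l ?pT' // lt_neqAle wgen // oT.
  by apply: ler_sum => r /andP [rT' _]; rewrite ler_pM2l ?pT' // oT.
move=> oS oS' pS pS'; case: (boolP (S \subset S')) => sS'.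
  apply/eqP; rewrite eqEcard sS' /=.
  case/andP: oS => /coordmxP bS _; case/andP: oS' => /coordmxP bS' _.
  by rewrite (card_basis bS) (card_basis bS').
case: (boolP (S' \subset S)) => s'S; last first.
  by have := lt_trans (lt _ _ oS oS' pS' s'S) (lt _ _ oS' oS pS sS'); rewrite ltxx.
apply/esym/eqP; rewrite eqEcard s'S /=.
case/andP: oS => /coordmxP bS _; case/andP: oS' => /coordmxP bS' _.
by rewrite (card_basis bS) (card_basis bS').
Qed.

(** The simplex method: among the bases in which [y] is nonnegative, one minimizing the dual value
    is a cell, because a row violating optimality could enter the basis and lower the value. *)
Lemma cell_exists S0 y : basisb S0 -> cone A y ->
  (forall S s, basisb S -> s \in S -> coord (coordmx S) y s != 0) ->
  exists2 S, cell S & forall s, s \in S -> 0 < coord (coordmx S) y s.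
Proof.
move=> bS0 Cy yn.
have [S1 bS1 pS1] : exists2 S, basisb S & [forall s in S, 0 <= coord (coordmx S) y s].
  have [l [l0 yE iA]] := caratheodory Cy.
  have [S [X [BS sS]]] := indep_extend (coordmxP bS0) iA.
  exists S; first exact: basisbE BS.
  have BS' := coordmxP (basisbE BS).
  apply/forall_inP => s sS'.
  by rewrite yE (coord_mulmx BS').
pose S := [arg min_(S < S1 | basisb S && [forall s in S, 0 <= coord (coordmx S) y s]) dual S y]%O.
have [bS pS Smin] : [/\ basisb S, forall s, s \in S -> 0 < coord (coordmx S) y s &
    forall S', basisb S' -> (forall s, s \in S' -> 0 <= coord (coordmx S') y s) -> dual S y <= dual S' y].
  rewrite /S; case: Order.TotalTheory.arg_minP => [|S' /andP [bS' /forall_inP pS'] H].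
    by rewrite bS1.
  split=> // [s sS|T bT pT]; first by rewrite lt_neqAle eq_sym yn // pS'.
  by apply: H; rewrite bT; apply/forall_inP.
exists S => //; rewrite /cell bS; apply/forallP => i; rewrite leNgt; apply/negP => wi.
have iS : i \notin S by apply: contraTN wi => iS; rewrite dual_in // ltxx.
have BS := coordmxP bS; pose c := coord (coordmx S) (row i A).
(* The coordinates of [row i A] sum to its height 1, so one of them is positive. *)
have [s0 s0S cs0] : exists2 s, s \in S & 0 < c s.
  apply: contrapT => H; have := coord_height (row i A) BS.
  rewrite mxE A1 => /eqP; apply/negP; rewrite lt_eqF // (@le_lt_trans _ _ 0) //.
  apply: sumr_le0 => s sS; rewrite leNgt; apply/negP => Hs; apply: H.
  by exists s.
(* Ratio test for the leaving element; [th] below is the coordinate that the entering row [i]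
   receives. *)
pose s := [arg min_(s < s0 | (s \in S) && (0 < c s)) (coord (coordmx S) y s / c s)]%O.
have [sS cs smin] : [/\ s \in S, 0 < c s & forall t, t \in S -> 0 < c t ->
    coord (coordmx S) y s / c s <= coord (coordmx S) y t / c t].
  rewrite /s; case: Order.TotalTheory.arg_minP => [|t /andP [tS ct] H].
    by rewrite s0S.
  by split=> // t' t'S ct'; apply: H; rewrite t'S.
have [X' BS'] := basis_pivot BS sS iS (lt0r_neq0 cs).
pose th := coord (coordmx S) y s / c s.
have th0 : 0 < th by rewrite divr_gt0 // pS.
pose f t := if t == i then th else coord (coordmx S) y t - th * c t.
have yE : y = \sum_(t in i |: S :\ s) f t *: row t A.
  rewrite big_setU1 /=; last by rewrite !inE (negPf iS) andbF.
  rewrite /f eqxx; under eq_bigr => t tS.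
    rewrite ifF; last by apply: contraNF iS => /eqP <-; move: tS; rewrite inE => /andP [].
    over.
  have := coord_expand BS y; have := coord_expand BS (row i A).
  rewrite (big_setD1 s) //= -/(c s) => e1; rewrite (big_setD1 s) //= => e2.
  under eq_bigr do rewrite scalerBl -scalerA.
  rewrite sumrB -scaler_sumr.
  have -> : \sum_(t in S :\ s) c t *: row t A = row i A - c s *: row s A.
    by rewrite [in RHS]e1 addrC addrK.
  rewrite scalerBr scalerA divfK ?gt_eqF // {1}e2.
  have key (a b d : 'rV[R]_n.+1) : b + d = a + (d - (a - b)).
    by apply/rowP => j; rewrite !mxE; ring.
  exact: key.
have coordE' t : t \in i |: S :\ s -> coord (coordmx (i |: S :\ s)) y t = f t.
  by move=> tS'; rewrite {1}yE (coord_comb (coordmxP (basisbE BS'))) // tS'.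
(* The value drops by [th * (dual S (row i A) - w 0 i)], which is positive by [wi]. *)
have : dual (i |: S :\ s) y < dual S y.
  rewrite /dual (eq_bigr (fun t => f t * w 0 t)); last by move=> t /coordE' ->.
  rewrite big_setU1 /=; last by rewrite !inE (negPf iS) andbF.
  rewrite {1}/f eqxx; under eq_bigr => t tS.
    rewrite /f ifF; last by apply: contraNF iS => /eqP <-; move: tS; rewrite inE => /andP [].
    rewrite mulrBl -mulrA; over.
  rewrite sumrB -mulr_sumr /= (big_setD1 s sS) /=.
  move: wi; rewrite /dual (big_setD1 s sS) /= -/(c s).
  have <- : th * c s = coord (coordmx S) y s by rewrite divfK // gt_eqF.
  rewrite -(ltr_pM2l th0) mulrDr mulrA; rewrite -/c; lra.
apply/negP; rewrite -leNgt; apply: Smin (basisbE BS') _ => t tS'.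
rewrite coordE' // /f; case: ifPn => [_|ti]; first exact: ltW.
have tS : t \in S by move: tS'; rewrite !inE (negPf ti) => /andP [].
have yt := pS t tS; have [ct|ct] := ltP 0 (c t).
  by rewrite subr_ge0 -ler_pdivlMr // smin.
by rewrite subr_ge0 (le_trans _ (ltW yt)) // mulr_ge0_le0 // ltW.
Qed.

(* The half-open cell of points [z] such that [z + e u] is interior to the cone over [S]
   for all small [e > 0]. *)
Definition signed u S z :=
  [forall s in S, (0 < coord (coordmx S) z s) || (coord (coordmx S) z s == 0) && (0 < coord (coordmx S) u s)].

(** [u] avoids every hyperplane spanned by a facet of a simplicial cone. *)
Definition regular_dir u := forall S s, basisb S -> s \in S -> coord (coordmx S) u s != 0.

(** A small step along [u] keeps the nonzero signs and breaks ties by the sign of [u]; finitely many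
    pairs [(S, s)] admit a common step size. *)
Lemma perturb u z : regular_dir u -> exists e, 0 < e /\ forall e', 0 < e' -> e' <= e ->
  forall S s, basisb S -> s \in S -> coord (coordmx S) (z + e' *: u) s != 0 /\
    (0 < coord (coordmx S) (z + e' *: u) s) =
    ((0 < coord (coordmx S) z s) || (coord (coordmx S) z s == 0) && (0 < coord (coordmx S) u s)).
Proof.
move=> ru.
have [|t|e [e0 He]] := @fin_small R ({set 'I_N} * 'I_N)%type (fun t e => forall e', 0 < e' -> e' <= e ->
   basisb t.1 -> t.2 \in t.1 -> coord (coordmx t.1) (z + e' *: u) t.2 != 0 /\
    (0 < coord (coordmx t.1) (z + e' *: u) t.2) =
    ((0 < coord (coordmx t.1) z t.2) || (coord (coordmx t.1) z t.2 == 0) && (0 < coord (coordmx t.1) u t.2))).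
- by move=> t e e' e'0 e'e H f f0 fe'; apply: H => //; apply: le_trans e'e.
- case: t => S s /=; set a := coord _ z s; set b := coord _ u s.
  (* This threshold forces [|e * b| < |a|]. *)
  exists (if a == 0 then 1 else `|a| / 2 / (1 + `|b|)); split.
    case: ifPn => [//|an]; rewrite !divr_gt0 ?normr_gt0 //.
    by rewrite ltr_pwDl.
  move=> e e0 He bS sS; have bn : b != 0 by apply: ru.
  rewrite coordD coordZ -/a -/b; move: He; case: (eqVneq a 0) => [-> _|an].
    by rewrite add0r ltxx ?eqxx /= pmulr_rgt0 // mulf_neq0 // gt_eqF.
  have b1 : 0 < 1 + `|b| by rewrite ltr_pwDl.
  rewrite /= ler_pdivlMr // orbF => He.
  have eb : `|e * b| < `|a|.
    rewrite normrM (gtr0_norm e0); have : 0 < `|a| by rewrite normr_gt0.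
    move: He; rewrite mulrDr mulr1; lra.
  have [ap|am] := ltP 0 a.
    move: eb; rewrite (gtr0_norm ap) ltr_norml => /andP [e1 e2].
    have h : 0 < a + e * b by lra.
    by split; [rewrite gt_eqF | rewrite h].
  move: eb; rewrite (ler0_norm am) ltr_norml => /andP [e1 e2].
  have h : a + e * b < 0 by lra.
  split; first by rewrite lt_eqF.
  by apply/negbTE; rewrite -leNgt ltW.
by exists e; split=> // e' e'0 e'e S s bS sS; apply: (He (S, s)).
Qed.

(** The half-open cells cover: the perturbed point [z + g *: u] is generic, hence interior to a
    cell, and [perturb] translates this back to [z]. *)
Lemma signed_exists S0 u z : basisb S0 -> regular_dir u -> cone A z -> tangent_cone A z u ->
  exists2 S, cell S & signed u S z.
Proof.
move=> bS0 ru Cz [e e0 Ce]; have [f [f0 Hf]] := perturb z ru.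
pose g := Num.min e f.
have g0 : 0 < g by rewrite lt_min e0.
have Cg : cone A (z + g *: u).
  by apply: tangent_cone_le Ce _ _; [done | exact: ltW | rewrite /g ge_min lexx].
have gf : g <= f by rewrite /g ge_min lexx orbT.
have {}Hf := Hf g g0 gf.
have [|S oS pS] := cell_exists bS0 Cg; first by move=> S s bS sS; case: (Hf S s bS sS).
exists S => //; apply/forall_inP => s sS.
have /andP [bS _] := oS; have [_ <-] := Hf S s bS sS.
exact: pS.
Qed.

Lemma signed_uniq u z S S' : regular_dir u -> cell S -> cell S' ->
  signed u S z -> signed u S' z -> S = S'.
Proof.
move=> ru oS oS' /forall_inP sS /forall_inP sS'.
have [f [f0 Hf]] := perturb z ru; have {}Hf := Hf f f0 (lexx _).
apply: (@cell_uniq (z + f *: u)) => // s sin.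
  by case/andP: oS => bS _; have [_ ->] := Hf S s bS sin; apply: sS.
by case/andP: oS' => bS _; have [_ ->] := Hf S' s bS sin; apply: sS'.
Qed.

End Triangulation.

(** Multiplication of the generating function by [1 - t]; the value before index 0 is taken to be
    0. *)
Definition bdiff (f : nat -> int) (m : nat) : int := f m - (if m is m'.+1 then f m' else 0).

Lemma eq_iter_bdiff p f g : f =1 g -> iter p bdiff f =1 iter p bdiff g.
Proof.
move=> e; elim: p => //= p IH [|m]; by rewrite /bdiff !IH.
Qed.

Lemma iter_bdiff_sum p (I : finType) (P : pred I) (F : I -> nat -> int) m :
  iter p bdiff (fun m => \sum_(i | P i) F i m) m = \sum_(i | P i) iter p bdiff (F i) m.
Proof.
elim: p m => //= p IH [|m]; rewrite /bdiff !IH; first by rewrite subr0; apply: eq_bigr => i _; rewrite subr0.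
by rewrite -sumrB.
Qed.

Lemma exchange_count (T : Type) (I : finType) (P : pred I) (F : I -> pred T) (s : seq T) :
  (\sum_(i | P i) count (F i) s = \sum_(z <- s) \sum_(i | P i) F i z)%N.
Proof.
rewrite exchange_big /=; apply: eq_bigr => i _.
by rewrite -sum1_count big_mkcond.
Qed.

Lemma size_le_sum_count (T : eqType) (I : finType) (P : pred I) (F : I -> pred T) (s : seq T) :
  (forall z, z \in s -> exists2 i, P i & F i z) -> (size s <= \sum_(i | P i) count (F i) s)%N.
Proof.
move=> H; rewrite exchange_count -sum1_size big_seq [leqRHS]big_seq.
by apply: leq_sum => z /H [i Pi Fi]; rewrite (bigD1 i) //= Fi.
Qed.

Lemma sum_count_le (T : eqType) (I : finType) (P : pred I) (F : I -> pred T) (G : pred T)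
    (s : seq T) :
  (forall z i j, z \in s -> P i -> P j -> F i z -> F j z -> i = j) ->
  (forall z i, z \in s -> P i -> F i z -> G z) ->
  (\sum_(i | P i) count (F i) s <= count G s)%N.
Proof.
move=> Hu HG; rewrite exchange_count -sum1_count [leqRHS]big_mkcond big_seq [leqRHS]big_seq.
apply: leq_sum => z zs.
case: (pickP (fun i => P i && F i z)) => [i /andP [Pi Fi]|none].
  rewrite (bigD1 i) //= Fi (HG z i) // big1 // => j /andP [Pj ji].
  by apply/eqP; rewrite eqb0; apply: contra ji => Fj; apply/eqP; apply: Hu Fj Fi.
by rewrite big1 // => i Pi; have := none i; rewrite Pi /= => ->.
Qed.

(** * Box points, the h*-vector and reciprocity *)

Section Count.
Variables (R : realType) (N n : nat) (A : 'M[R]_(N, n.+1)).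
Hypothesis A1 : forall i, A i 0 = 1.
Hypothesis Aint : forall i j, A i j \is a Num.int.

Definition latpt (z : 'rV[R]_n.+1) := forall j, z 0 j \is a Num.int.

Lemma latpt_row i : latpt (row i A).
Proof. by move=> j; rewrite mxE. Qed.
Lemma latptD y z : latpt y -> latpt z -> latpt (y + z).
Proof. by move=> Ly Lz j; rewrite mxE rpredD. Qed.
Lemma latptB y z : latpt y -> latpt z -> latpt (y - z).
Proof. by move=> Ly Lz j; rewrite !mxE rpredB. Qed.
Lemma latptZ t z : t \is a Num.int -> latpt z -> latpt (t *: z).
Proof. by move=> t0 Lz j; rewrite mxE rpredM. Qed.
Lemma latpt_sum (I : finType) (P : pred I) (F : I -> 'rV[R]_n.+1) :
  (forall i, P i -> latpt (F i)) -> latpt (\sum_(i | P i) F i).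
Proof. by move=> H j; rewrite summxE rpred_sum // => i Pi; apply: H. Qed.

Variable w : 'rV[R]_N.
Hypothesis w0 : forall i, 0 < w 0 i.
Hypothesis wgen : forall S i, basisb A S -> i \notin S -> dual A w S (row i A) != w 0 i.
Let q := w *m A.
Hypothesis qreg : regular_dir A q.
Variable S0 : {set 'I_N}.
Hypothesis bS0 : basisb A S0.

Variable slice_pts : nat -> seq 'rV[R]_n.+1.
Hypothesis slice_pts_uniq : forall m, uniq (slice_pts m).
Hypothesis slice_ptsP : forall m z, reflect [/\ latpt z, cone A z & z 0 0 = m%:R] (z \in slice_pts m).

Let cell := cell A w.
Let sgn := signed A q.

(** Interpolates between the half-open cell ([T] empty) and its half-open fundamental box
    ([T = S]). *)
Definition partbox (S T : {set 'I_N}) (z : 'rV[R]_n.+1) :=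
  signed A q S z && [forall s in T, ~~ signed A q S (z - row s A)].

Lemma signed_cone S u z : basisb A S -> signed A u S z -> cone A z.
Proof.
move=> /coordmxP BS /forall_inP H; apply: (cone_coord BS) => s sS.
by case/orP: (H s sS) => [/ltW //|/andP [/eqP -> _]].
Qed.

Lemma signed_sub S u z s t : basisb A S -> s \in S -> t \in S -> s != t ->
  signed A u S (z - row s A) -> signed A u S (z - row t A) ->
  signed A u S (z - row s A - row t A).
Proof.
move=> /coordmxP BS sS tS st /forall_inP Hs /forall_inP Ht; apply/forall_inP => r rS.
have := Hs r rS; have := Ht r rS; rewrite !(coordB, coord_row BS) //.
have [->|rt] := eqVneq r t; first by rewrite (negPf st) subr0.
by rewrite !subr0.
Qed.

Lemma signed_add S u z t : basisb A S -> t \in S ->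
  signed A u S (z - row t A) -> signed A u S z.
Proof.
move=> /coordmxP BS tS /forall_inP Ht; apply/forall_inP => r rS.
have := Ht r rS; rewrite !(coordB, coord_row BS) //.
case: eqVneq => _; rewrite ?subr0 //= mulr1n.
case/orP => [h|/andP [/eqP h _]]; apply/orP; left; lra.
Qed.

(** Adding [s] to [T] discards exactly the translate of [partbox S T] by [row s A], which lives one
    height further up. *)
Lemma partbox_step S (T : {set 'I_N}) s m : basisb A S -> T \subset S -> s \in S -> s \notin T ->
  (count (partbox S (s |: T)) (slice_pts m))%:Z =
   bdiff (fun m => (count (partbox S T) (slice_pts m))%:Z) m.
Proof.
move=> bS TS sS sT.
pose Q z := sgn S (z - row s A).
have -> : count (partbox S (s |: T)) (slice_pts m) = count (predC Q) (filter (partbox S T) (slice_pts m)).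
  rewrite count_filter; apply: eq_count => z /=; rewrite /partbox /Q.
  apply/andP/andP => [[sz /forall_inP H]|[nQ /andP [sz /forall_inP H]]].
    split; first by apply: H; exact: setU11.
    by rewrite sz; apply/forall_inP => t tT; apply: H; exact: setU1r.
  split=> //; apply/forall_inP => t; rewrite !inE => /orP [/eqP -> //|]; exact: H.
have := count_predC Q (filter (partbox S T) (slice_pts m)).
rewrite size_filter /bdiff => <-; rewrite PoszD addrAC -[LHS]add0r; congr (_ + _).
apply/esym/eqP; rewrite subr_eq0; apply/eqP.
(* At height 0 nothing is discarded, since [z - row s A] would be a cone point of negative
   height. *)
case: m => [|m].
  congr Posz; apply/eqP; rewrite -leqn0 leqNgt -has_count; apply/hasPn => z.
  rewrite mem_filter => /andP [_ /slice_ptsP [_ _ z0]]; apply/negP => /(signed_cone bS) /(cone_height A1).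
  by rewrite !mxE z0 A1; lra.
congr Posz; rewrite -!size_filter -[RHS](size_map (fun z => z + row s A)).
apply: perm_size; apply: uniq_perm; rewrite ?filter_uniq //.
  by rewrite map_inj_uniq ?filter_uniq // => y z /addIr.
move=> z; rewrite mem_filter mem_filter; apply/idP/mapP.
  case/and3P => Qz /andP [sz /forall_inP Hz] /slice_ptsP [Lz Cz z0].
  exists (z - row s A); rewrite ?subrK // mem_filter; apply/andP; split; last first.
    apply/slice_ptsP; split; first by apply: latptB => //; exact: latpt_row.
      exact: signed_cone bS Qz.
    by rewrite !mxE z0 A1 -natr1 addrK.
  apply/andP; split; first exact: Qz.
  apply/forall_inP => t tT; apply/negP => St.
  move/negP: (Hz t tT); apply; apply: (signed_add (t := s)) => //.
  by rewrite addrAC.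
case=> y; rewrite mem_filter => /andP [/andP [sy /forall_inP Hy] /slice_ptsP [Ly Cy y0]] ->.
rewrite /Q addrK -andbA; apply/and4P; split; first exact: sy.
- by apply: (signed_add (t := s)); rewrite ?addrK.
- apply/forall_inP => t tT; apply/negP => St; move/negP: (Hy t tT); apply.
  rewrite -[y](addrK (row s A)); apply: signed_sub => //; rewrite ?addrK //.
    exact: (subsetP TS).
  by apply: contraNneq sT => ->.
apply/slice_ptsP; split; first by apply: latptD => //; exact: latpt_row.
  by apply: coneD => //; exact: cone_row.
by rewrite !mxE y0 A1 -natr1.
Qed.

Lemma count_partbox S (T : {set 'I_N}) m : basisb A S -> T \subset S ->
  (count (partbox S T) (slice_pts m))%:Z =
   iter #|T| bdiff (fun m => (count (sgn S) (slice_pts m))%:Z) m.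
Proof.
move=> bS; have [k] := ubnP #|T|; elim: k => // k IH in T m *; rewrite ltnS => Tk TS.
have [->|[s sT]] := set_0Vmem T.
  rewrite cards0 /=; congr Posz; apply: eq_count => z.
  by rewrite /partbox andbC (_ : [forall s in _, _]) //; apply/forall_inP => s; rewrite inE.
have sS := subsetP TS _ sT.
rewrite -(setD1K sT) partbox_step //; last 2 first.
- exact: subset_trans (subsetDl _ _) TS.
- by rewrite !inE eqxx.
rewrite cardsU1 !inE eqxx /=; rewrite (cardsD1 s) sT in Tk.
have E m' := IH (T :\ s) m' Tk (subset_trans (subsetDl _ _) TS).
by case: m => [|m]; rewrite /bdiff !E.
Qed.

Definition box S := partbox S S.

(** The half-open cells partition the lattice points of the cone, and [n + 1] differences turn the
    count of each cell into the count of its box. *)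
Lemma hstar_box m : iter n.+1 bdiff (fun m => (size (slice_pts m))%:Z) m =
  \sum_(S | cell S) (count (box S) (slice_pts m))%:Z.
Proof.
rewrite (@eq_iter_bdiff _ _ (fun m => \sum_(S | cell S) (count (sgn S) (slice_pts m))%:Z)).
  rewrite iter_bdiff_sum; apply: eq_bigr => S /andP [bS _].
  by rewrite count_partbox // (card_basis (coordmxP bS)).
move=> j; rewrite -(big_morph Posz PoszD (erefl _)); congr Posz.
apply/eqP; rewrite eqn_leq; apply/andP; split.
  apply: size_le_sum_count => z /slice_ptsP [_ Cz _].
  (* As [w] is positive, [q] lies in the cone and hence is a feasible direction at every cone
     point. *)
  by apply: (signed_exists A1 w bS0 qreg Cz); apply: tangent_cone_cone => //; exists w; split=> // i; exact: ltW.
rewrite -(count_predT (slice_pts j)); apply: sum_count_le => // z S S' _.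
exact: signed_uniq.
Qed.

(** Integer part for the reversed direction [- q]: the remainder lies in [(0, 1]] where [q] is
    positive and in [[0, 1)] where it is negative. One minus the remainder then falls in the box for
    [q]. *)
Definition ofloor (z : 'rV[R]_n.+1) S s : int :=
  if 0 < coord (coordmx A S) q s then Num.ceil (coord (coordmx A S) z s) - 1 else Num.floor (coord (coordmx A S) z s).

(** Reciprocity: at an interior point even [- q] is feasible, so [z] lies in a half-open cell for
    [- q]; complementing its fractional part gives a box point for [q]. *)
Lemma box_compl z : latpt z -> interior_cone A z ->
  exists S (c : 'I_N -> nat), [/\ cell S, signed A (- q) S z &
    let b := \sum_(s in S) (1 + (c s)%:R) *: row s A - z in latpt b /\ box S b].
Proof.
move=> Lz Iz; have Cz := interior_cone_cone Iz.
have [|S oS sS] := signed_exists A1 w bS0 _ Cz (Iz (- q)).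
  by move=> S s bS sS; rewrite coordN oppr_eq0 qreg.
have bS : basisb A S by case/andP: oS.
have BS := coordmxP bS.
exists S, (fun s => `|ofloor z S s|%N); split=> //=.
have sgnz s : s \in S -> (0 < coord (coordmx A S) z s) || (coord (coordmx A S) z s == 0) && (coord (coordmx A S) q s < 0).
  by move=> sin; have := forall_inP sS s sin; rewrite coordN oppr_gt0.
have cE s : s \in S -> (`|ofloor z S s|%N)%:R = (ofloor z S s)%:~R :> R.
  move=> sin; rewrite natr_absz ger0_norm //; have := sgnz s sin; rewrite /ofloor.
  case: (ltP 0 (coord (coordmx A S) q s)) => [q0|q0 z0].
    rewrite (lt_gtF q0) andbF orbF => z0.
    by rewrite subr_ge0 -gtz0_ge1 ceil_gt0.
  by rewrite floor_ge0; case/orP: z0 => [/ltW //|/andP [/eqP -> _]].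
split.
  apply: latptB => //; apply: latpt_sum => s sin; apply: latptZ; last exact: latpt_row.
  by rewrite rpredD ?rpred1 // natr_int.
have bE s : s \in S -> coord (coordmx A S) (\sum_(s in S) (1 + (`|ofloor z S s|%N)%:R) *: row s A - z) s =
    1 + (ofloor z S s)%:~R - coord (coordmx A S) z s.
  by move=> sin; rewrite coordB (coord_comb BS) // sin cE.
apply/andP; split; apply/forall_inP => s sin.
  rewrite bE // /ofloor; have := qreg bS sin.
  set x := coord _ z s; case: (ltgtP 0 (coord (coordmx A S) q s)) => [q0|q0|//] _ /=.
    rewrite andbT orbC -[_ == 0]eq_sym -le_eqVlt.
    have := ceil_ge x; rewrite intrB; lra.
  apply/orP; left; have /andP [_] := floor_itv x; rewrite intrD; lra.
apply/negP => /forall_inP/(_ s sin); rewrite coordB bE // (coord_row BS) // eqxx mulr1n /ofloor.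
have := qreg bS sin; set x := coord _ z s; case: (ltgtP 0 (coord (coordmx A S) q s)) => [q0|q0|//] _ /=.
  have := ceilB1_lt x; rewrite andbT orbC -[_ == 0]eq_sym -le_eqVlt intrB; lra.
by have := floor_le x; rewrite andbF orbF; lra.
Qed.

Lemma box_cone S z : cell S -> box S z -> cone A z.
Proof. by case/andP => bS _ /andP [sz _]; apply: signed_cone bS sz. Qed.

Lemma height_nat z : latpt z -> cone A z -> exists m : nat, z 0 0 = m%:R.
Proof.
by move=> Lz /(cone_height A1) z0; apply/natrP; rewrite natrEint Lz.
Qed.

(* The [a]-coordinate of [z] is an integer in [0, 1): since [q] is positive along [a],
   the facet opposite to [a] is never removed from a half-open cell. *)
Lemma box_apex S z T XT a : cell S -> latpt z -> box S z -> is_basis A T XT -> a \in T ->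
  (forall y, latpt y -> coord XT y a \is a Num.int) ->
  (forall i, row i A = row a A \/ coord XT (row i A) a = 0) -> coord XT z a = 0.
Proof.
move=> oS Lz /andP [/forall_inP sz /forall_inP nz] BT aT aint aV.
have /andP [bS _] := oS; have BS := coordmxP bS.
have [s sS cs] : exists2 s, s \in S & coord XT (row s A) a != 0.
  apply: contrapT => H; have := coord_row BT a aT; rewrite eqxx (coord_expand BS (row a A)) coord_sum big1.
    by move/esym/eqP; rewrite oner_eq0.
  move=> s sS; rewrite coordZ; apply/eqP; rewrite mulf_eq0; apply/orP; right.
  by apply/negPn/negP => Hs; apply: H; exists s.
have sE : row s A = row a A by case: (aV s) => // e; rewrite e eqxx in cs.
have key y : coord XT y a = coord (coordmx A S) y s.
  rewrite [in LHS](coord_expand BS y) coord_sum (bigD1 s) //= coordZ sE (coord_row BT) // eqxx mulr1.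
  rewrite big1 ?addr0 // => t /andP [tS ts]; rewrite coordZ.
  case: (aV t) => [e|->]; last by rewrite mulr0.
  have := coord_row BS s tS; rewrite e -sE (coord_row BS) // eqxx (negPf ts) => /eqP.
  by rewrite oner_eq0.
have q0 : 0 < coord (coordmx A S) q s.
  rewrite -key /q mulmx_sum_row coord_sum (bigD1 a) //= ltr_pwDl //.
    by rewrite coordZ (coord_row BT) // eqxx mulr1.
  apply: sumr_ge0 => i _; rewrite coordZ; apply: mulr_ge0; first exact: ltW.
  by case: (aV i) => [->|->//]; rewrite (coord_row BT) // eqxx.
have z0 : 0 <= coord (coordmx A S) z s by case/orP: (sz s sS) => [/ltW //|/andP [/eqP -> _]].
have z1 : coord (coordmx A S) z s < 1.
  rewrite ltNge; apply/negP => z1; move/negP: (nz s sS); apply; apply/forall_inP => t tS.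
  rewrite coordB (coord_row BS) //; have := sz t tS; case: (eqVneq s t) => [<- _|_]; last by rewrite subr0.
  by rewrite mulr1n q0 andbT orbC eq_sym -le_eqVlt subr_ge0.
have /intrP [m] := aint z Lz; rewrite key => mE; rewrite mE in z0 z1 *.
move: z0 z1; rewrite ler0z -[1]/(1%:~R) ltr_int => m0 m1.
by have -> : m = 0 by lia.
Qed.

(** Boxes of different cells are disjoint, and all box points have zero coordinates along [B]. *)
Lemma hstar_le_apex T XT (B : {set 'I_N}) m : is_basis A T XT -> B \subset T ->
  (forall a y, a \in B -> latpt y -> coord XT y a \is a Num.int) ->
  (forall a i, a \in B -> row i A = row a A \/ coord XT (row i A) a = 0) ->
  iter n.+1 bdiff (fun m => (size (slice_pts m))%:Z) m <=
  (count (fun z => [forall a in B, coord XT z a == 0]) (slice_pts m))%:Z.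
Proof.
move=> BT BTs Bint BV; rewrite hstar_box -(big_morph Posz PoszD (erefl _)) lez_nat.
apply: sum_count_le.
  by move=> z S S' _ oS oS' /andP [sz _] /andP [sz' _]; exact: (signed_uniq wgen qreg oS oS' sz sz').
move=> z S /slice_ptsP [Lz _ _] oS bz; apply/forall_inP => a aB; apply/eqP.
apply: (box_apex oS Lz bz BT (subsetP BTs _ aB)) => [y|i]; [exact: Bint | exact: BV].
Qed.

Variables d k : nat.
Hypothesis hdeg : forall i, (d < i)%N -> iter n.+1 bdiff (fun m => (size (slice_pts m))%:Z) i = 0.
Hypothesis hlead : iter n.+1 bdiff (fun m => (size (slice_pts m))%:Z) d = k%:Z.

Lemma box_height_le S z m : cell S -> latpt z -> box S z -> z 0 0 = m%:R -> (m <= d)%N.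
Proof.
move=> oS Lz Bz zm; rewrite leqNgt; apply/negP => /hdeg; rewrite hstar_box.
rewrite -(big_morph Posz PoszD (erefl _)) => -[/eqP]; apply/negP.
rewrite -lt0n (bigD1 S) //= addn_gt0 -has_count; apply/orP; left.
by apply/hasP; exists z => //; apply/slice_ptsP; split=> //; apply: box_cone Bz.
Qed.

(** The heights of [z] and of its complementary box point add up to [n + 1 + c], and a box point has
    height at most [d]. The clause for [c = 0] serves the points of least height. *)
Lemma box_compl_height z : latpt z -> interior_cone A z ->
  exists S (c : nat) v, [/\ cell S, n.+1%:R + c%:R <= z 0 0 + d%:R,
    (c = 0%N -> v = \sum_(s in S) row s A), latpt (v - z) & box S (v - z)].
Proof.
move=> Lz Iz; have [S [c [oS sS [Lb Bb]]]] := box_compl Lz Iz.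
exists S, (\sum_(s in S) c s)%N, (\sum_(s in S) (1 + (c s)%:R) *: row s A); split=> //; last first.
  move=> /eqP; rewrite sum_nat_eq0 => /forall_inP c0; apply: eq_bigr => s sS'.
  by rewrite (eqP (c0 s sS')) addr0 scale1r.
have [m bm] := height_nat Lb (box_cone oS Bb).
have := box_height_le oS Lb Bb bm; rewrite -(ler_nat R) -bm 2!mxE summxE.
under [X in X - _ <= _ -> _]eq_bigr => s _ do rewrite !mxE A1 mulr1.
rewrite big_split /= sumr_const; have /andP [/coordmxP bS _] := oS.
rewrite (card_basis bS) natr_sum; lra.
Qed.

Lemma int_height z : latpt z -> interior_cone A z -> n.+1%:R <= z 0 0 + d%:R.
Proof.
move=> Lz /(box_compl_height Lz) [S [c [v [_ H _ _ _]]]].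
by apply: le_trans H; rewrite lerDl.
Qed.

(** At least height [c = 0] is forced, so within a cell [z] is recovered from the box point [f S z]
    of height [d]; there are [k] such box points in all. *)
Lemma int_count (s : seq 'rV[R]_n.+1) : uniq s ->
  (forall z, z \in s -> [/\ latpt z, interior_cone A z & z 0 0 + d%:R = n.+1%:R]) -> (size s <= k)%N.
Proof.
move=> us Hs; pose f (S : {set 'I_N}) (z : 'rV[R]_n.+1) := \sum_(t in S) row t A - z.
rewrite -lez_nat -hlead hstar_box -(big_morph Posz PoszD (erefl _)) lez_nat.
have H1 : (size s <= \sum_(S | cell S) count (fun z => (f S z \in slice_pts d) && box S (f S z)) s)%N.
  apply: size_le_sum_count => z /Hs [Lz Iz zd].
  have [S [c [v [oS H vE Lb Bb]]]] := box_compl_height Lz Iz.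
  have /vE vS : c = 0%N.
    by apply/eqP; rewrite -(eqr_nat R) eq_le ler0n andbT; move: H; rewrite zd; lra.
  exists S => //; rewrite vS in Lb Bb; rewrite Bb andbT.
  apply/slice_ptsP; split=> //; first exact: box_cone Bb.
  rewrite !mxE summxE; under eq_bigr => t _ do rewrite mxE A1.
  by rewrite sumr_const; have /andP [/coordmxP bS _] := oS; rewrite (card_basis bS) -zd addrAC subrr add0r.
apply: leq_trans H1 _; apply: leq_sum => S oS; rewrite -!size_filter -(size_map (f S)).
apply: uniq_leq_size.
  by rewrite map_inj_uniq ?filter_uniq // => y z /addrI /oppr_inj.
by move=> _ /mapP [z + ->]; rewrite !mem_filter => /andP [/andP [-> ->]].
Qed.

(** Converse complementation: a box point [b] of height [d] gives the point with coordinates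
    [1 - b_s]. *)
Lemma int_exists : (0 < k)%N -> exists x, [/\ latpt x, interior_cone A x & x 0 0 + d%:R = n.+1%:R].
Proof.
move=> k0; move: hlead; rewrite hstar_box -(big_morph Posz PoszD (erefl _)) => -[kE].
have [S /andP [oS]] : exists S, cell S && (0 < count (box S) (slice_pts d))%N.
  apply/existsP; apply: contraLR k0; rewrite negb_exists -kE -leqNgt leqn0 sum_nat_eq0.
  move=> /forallP H; apply/forall_inP => S oS.
  by have := H S; rewrite oS /= -eqn0Ngt.
rewrite -has_count => /hasP [b /slice_ptsP [Lb Cb bd] /andP [/forall_inP sb /forall_inP nb]].
have /andP [bS _] := oS; have BS := coordmxP bS.
have zE s : s \in S -> coord (coordmx A S) (\sum_(s in S) 1 *: row s A - b) s = 1 - coord (coordmx A S) b s.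
  by move=> sS; rewrite coordB (coord_comb BS) // sS.
have zP s : s \in S -> coord (coordmx A S) b s < 1 \/ coord (coordmx A S) b s = 1 /\ coord (coordmx A S) q s < 0.
  move=> sS; case: (ltgtP (coord (coordmx A S) b s) 1) => [b1|b1|b1]; [by left| |].
    exfalso; move/negP: (nb s sS); apply; apply/forall_inP => t tS.
    rewrite coordB (coord_row BS) //; have := sb t tS; case: (eqVneq s t) => [<- _|_]; last by rewrite subr0.
    by rewrite mulr1n subr_gt0 b1.
  right; split=> //; rewrite ltNge; apply/negP => q0.
  move/negP: (nb s sS); apply; apply/forall_inP => t tS.
  rewrite coordB (coord_row BS) //; have := sb t tS; case: (eqVneq s t) => [<- _|_]; last by rewrite subr0.
  have q1 : 0 < coord (coordmx A S) q s by rewrite lt_neqAle eq_sym qreg.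
  by rewrite b1 mulr1n subrr eqxx q1 orbT.
exists (\sum_(s in S) 1 *: row s A - b); split.
- by apply: latptB => //; apply: latpt_sum => s _; apply: latptZ; [exact: rpred1 | exact: latpt_row].
(* The new point vanishes only at coordinates where [b] is 1, and there [q] is negative; as [q] lies
   in the cone, it supplies the missing negative directions. *)
- rewrite -[X in interior_cone _ X]addr0.
  apply: (@interior_cone_shift _ _ _ A S (coordmx A S) BS _ 0 (- q) [set s | coord (coordmx A S) b s == 1]).
  + by apply: (cone_coord BS) => s sS; rewrite zE // subr_ge0; case: (zP s sS) => [/ltW|[-> _]].
  + exact: cone0.
  + move=> s sS; rewrite inE => b1; exists (1 - coord (coordmx A S) b s).
      by rewrite subr_gt0; case: (zP s sS) => // -[/eqP]; rewrite (negPf b1).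
    apply: (cone_coord BS) => t tS; rewrite scalerN coordB coordZ (coord_row BS) // zE //.
    case: (eqVneq s t) => [->|_]; rewrite ?mulr1 ?subrr // mulr0 subr0 subr_ge0.
    by case: (zP t tS) => [/ltW|[-> _]].
  + rewrite opprK; apply: tangent_cone_cone; first exact: cone0.
    by exists w; split=> // i; exact: ltW.
  + move=> s sS; rewrite inE => /eqP b1; rewrite coordN oppr_gt0.
    by case: (zP s sS) => [|[] //]; rewrite b1 ltxx.
- rewrite !mxE summxE; under eq_bigr => t _ do rewrite !mxE A1 mulr1.
  by rewrite sumr_const (card_basis BS) bd subrK.
Qed.

End Count.

(** * Pyramid apices *)

Lemma card_bigcup_le (I T : finType) (P : pred I) (F : I -> {set T}) :
  (#|\bigcup_(i | P i) F i| <= \sum_(i | P i) #|F i|)%N.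
Proof.
elim/big_rec2: _ => [|i m s _ le]; first by rewrite cards0.
by apply: leq_trans (leq_card_setU _ _) _; rewrite leq_add2l.
Qed.

Section Reduction.
Variables (R : realType) (N n : nat) (A : 'M[R]_(N, n.+1)).
Hypothesis A1 : forall i, A i 0 = 1.
Hypothesis Aint : forall i j, A i j \is a Num.int.
Variables d k : nat.
(* By [int_low] below, [n + 1 - d] is the least possible height. *)
Definition low_interior (z : 'rV[R]_n.+1) := [/\ latpt z, interior_cone A z & z 0 0 + d%:R = n.+1%:R].
Hypothesis int_low : forall z, latpt z -> interior_cone A z -> n.+1%:R <= z 0 0 + d%:R.
Hypothesis int_few : forall s, uniq s -> (forall z, z \in s -> low_interior z) -> (size s <= k)%N.

Lemma progression_short y D m : D != 0 ->
  (forall l, (l <= m)%N -> low_interior (y + l%:R *: D)) -> (m < k)%N.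
Proof.
move=> Dn H; have := @int_few [seq y + l%:R *: D | l <- iota 0 m.+1].
rewrite size_map size_iota; apply.
  rewrite map_inj_uniq ?iota_uniq // => i j /addrI /eqP.
  rewrite -subr_eq0 -scalerBl scaler_eq0 (negPf Dn) orbF subr_eq0 eqr_nat => /eqP //.
by move=> _ /mapP [l + ->]; rewrite mem_iota add0n => /andP [_ lm]; apply: H.
Qed.

Lemma interior_cone_dom S X y z t : is_basis A S X -> interior_cone A z -> 0 < t ->
  (forall s, s \in S -> t * coord X z s <= coord X y s) -> interior_cone A y.
Proof.
move=> BS Iz t0 H; have -> : y = t *: z + (y - t *: z) by rewrite addrC subrK.
apply: interior_coneD; first exact: interior_coneZ.
by apply: (cone_coord BS) => s sS; rewrite coordB coordZ subr_ge0 H.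
Qed.

Lemma height_sum (P : pred 'I_N) : (\sum_(s | P s) row s A) 0 0 = #|P|%:R.
Proof.
rewrite summxE; under eq_bigr => s _ do rewrite mxE A1.
by rewrite sumr_const.
Qed.

Section Basis.
Variables (S : {set 'I_N}) (X : 'M[R]_(n.+1, N)).
Hypothesis BS : is_basis A S X.

(** If a coordinate exceeded 1, subtracting [row s A] would leave an interior lattice point below
    the least height. *)
Lemma coord_le1 x : low_interior x -> (forall s, s \in S -> 0 <= coord X x s) ->
  forall s, s \in S -> coord X x s <= 1.
Proof.
move=> [Lx Ix xd] x0 s sS; rewrite leNgt; apply/negP => x1.
have : interior_cone A (x - row s A).
  (* This [t] gives equality at coordinate [s]: [t * x_s = x_s - 1]. *)
  apply: (interior_cone_dom (t := 1 - (coord X x s)^-1) BS Ix).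
    by rewrite subr_gt0 invf_lt1 // (lt_trans _ x1).
  move=> t tS; rewrite coordB (coord_row BS) //; case: (eqVneq s t) => [<-|_].
    by rewrite mulr1n mulrBl mulVf ?mul1r // gt_eqF // (lt_trans _ x1).
  rewrite subr0 mulrBl mul1r lerBlDr lerDl mulr_ge0 ?x0 // invr_ge0.
  exact: le_trans (ltW x1).
move/(int_low (latptB Lx (latpt_row Aint s))).
by rewrite !mxE A1 -xd; lra.
Qed.

(** Reducing the coordinates of [z] and of [- z] to [(0, 1]] gives two interior lattice points. An
    integral coordinate contributes 2 to the sum of their heights and a non-integral one only 1,
    while the sum is at least [2 (n + 1 - d)]. *)
Lemma nonint_card z : latpt z -> (#|[set s in S | coord X z s \isn't a Num.int]| <= d.*2)%N.
Proof.
pose uf (y : R) := y - (Num.ceil y - 1)%:~R.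
have uf0 y : 0 < uf y by rewrite subr_gt0 ceilB1_lt.
have low y : latpt y -> n.+1%:R <= \sum_(s in S) uf (coord X y s) + d%:R.
  move=> Ly; pose b := \sum_(s in S) uf (coord X y s) *: row s A.
  have bE : b = y - \sum_(s in S) (Num.ceil (coord X y s) - 1)%:~R *: row s A.
    rewrite [X in _ = X - _](coord_expand BS y) -sumrB; apply: eq_bigr => s _.
    by rewrite -scalerBl.
  have Lb : latpt b.
    rewrite bE; apply: latptB => //; apply: latpt_sum => s _; apply: latptZ; first exact: intr_int.
    exact: (latpt_row Aint).
  have Ib : interior_cone A b.
    by apply: (interior_cone_coord BS) => s sS; rewrite (coord_comb BS) // sS.
  have := int_low Lb Ib; rewrite -(coord_height A1 b BS).
  by under eq_bigr => s sS do rewrite (coord_comb BS) // sS.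
move=> Lz; have LN : latpt (- z) by move=> j; rewrite mxE rpredN.
have := lerD (low z Lz) (low (- z) LN); rewrite addrACA -big_split /=.
have E : \sum_(s in S) (uf (coord X z s) + uf (coord X (- z) s)) =
   n.+1%:R * 2 - #|[set s in S | coord X z s \isn't a Num.int]|%:R.
  have -> : n.+1%:R * 2 = \sum_(s in S) 2 :> R.
    by rewrite sumr_const (card_basis BS) mulr_natl.
  rewrite -sum1_card natr_sum.
  have -> : \sum_(i in [set s in S | coord X z s \isn't a Num.int]) 1 =
     \sum_(i in S) (coord X z i \isn't a Num.int)%:R :> R.
    rewrite big_mkcond [RHS]big_mkcond; apply: eq_bigr => i _; rewrite inE.
    by case: (i \in S) => //=; case: (_ \isn't a _).
  rewrite -sumrB; apply: eq_bigr => s sS.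
  rewrite coordN /uf [Num.ceil (- _)]ceilNfloor opprK [Num.ceil _]ceil_floor.
  by rewrite !intrB !intrD /=; case: (_ \isn't a _); rewrite /= ?mulr1n ?mulr0n; lra.
rewrite E -[X in _ -> (_ <= X)%N]addnn -(ler_nat R) natrD; lra.
Qed.

Definition nonint_set := [set s in S | `[< exists2 z, latpt z & coord X z s \isn't a Num.int >]].

(* Averaging over random subset sums of witnesses: each coordinate of [nonint_set]
   is non-integral with probability at least 1/2. *)
Lemma nonint_set_card : (#|nonint_set| <= 4 * d)%N.
Proof.
have /choice [zz Hzz] : forall t : 'I_N, exists z : 'rV[R]_n.+1, latpt z /\
    (t \in nonint_set -> coord X z t \isn't a Num.int).
  move=> t.
  have [|tD] := boolP (t \in nonint_set).
    by rewrite inE => /andP [_ /asboolP [z Lz zt]]; exists z.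
  by exists 0; split=> // j; rewrite mxE rpred0.
pose zE (E : {set 'I_N}) := \sum_(t in E) zz t.
pose f s (E : {set 'I_N}) := nat_of_bool (coord X (zE E) s \isn't a Num.int).
have f2 E : (\sum_(s in nonint_set) f s E <= d.*2)%N.
  have LE : latpt (zE E) by apply: latpt_sum => t _; case: (Hzz t).
  apply: leq_trans (nonint_card LE); rewrite -sum1_card.
  rewrite big_mkcond [leqRHS]big_mkcond; apply: leq_sum => s _; rewrite !inE.
  by case: (s \in S) => //=; rewrite /f; case: (_ \isn't a _); case: ifP.
have f1 s : s \in nonint_set -> (#|{set 'I_N}| <= 2 * \sum_(E : {set 'I_N}) f s E)%N.
  (* Toggling [s] pairs the subsets; the two sums of a pair differ by the witness of [s], so one of
     them is non-integral at [s]. *)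
  move=> sD; pose tg (E : {set 'I_N}) := if s \in E then E :\ s else s |: E.
  have tgK : involutive tg.
    move=> E; rewrite /tg; case: (boolP (s \in E)) => sE; first by rewrite !inE eqxx /= setD1K.
    by rewrite setU11 setU1K.
  rewrite mul2n -addnn {2}(reindex_inj (inv_inj tgK)) -big_split /= -sum1_card.
  apply: leq_sum => E _; rewrite addn_gt0.
  have key (E' : {set 'I_N}) : s \notin E' -> (0 < f s E')%N || (0 < f s (s |: E'))%N.
    move=> sE'; rewrite /f !lt0b -negb_and; apply: contraL (sD) => /andP [i1 i2].
    apply/negP => /(proj2 (Hzz s)) /negP; apply.
    have -> : zz s = zE (s |: E') - zE E' by rewrite /zE big_setU1 //= addrK.
    by rewrite coordB rpredB.
  rewrite /tg; case: ifPn => sE; last by apply: key.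
  by rewrite orbC -{2}(setD1K sE); apply: key; rewrite !inE eqxx.
have : (#|nonint_set| * #|{set 'I_N}| <= (4 * d) * #|{set 'I_N}|)%N.
  apply: (@leq_trans (\sum_(s in nonint_set) 2 * \sum_(E : {set 'I_N}) f s E)%N).
    by rewrite -sum_nat_const; apply: leq_sum => s; apply: f1.
  rewrite -big_distrr /= exchange_big /= (_ : 4 * d = 2 * d.*2)%N; last by lia.
  rewrite -mulnA leq_mul2l /= [leqRHS]mulnC -sum_nat_const.
  by apply: leq_sum => E _; exact: f2.
by rewrite leq_pmul2r //; apply/card_gt0P; exists set0.
Qed.

Definition circuit i := [set s in S | coord X (row i A) s != 0].

(** The rows of [S] outside the positive part [P], plus [row i A], sum to an interior point; so do
    the rows outside the negative part [M], with nothing added. The least height bounds [P] by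
    [d + 1] and [M] by [d]. *)
Lemma circuit_card i : (#|circuit i| <= d.*2.+1)%N.
Proof.
pose P := [set s in S | 0 < coord X (row i A) s].
pose M := [set s in S | coord X (row i A) s < 0].
have base (B : {set 'I_N}) c W : B \subset S -> cone A c -> latpt c -> tangent_cone A c (- W) ->
    (forall s, s \in S -> s \in B -> 0 < coord X W s) -> #|B|%:R <= c 0 0 + d%:R.
  move=> BB Cc Lc Tc HW; pose y := \sum_(s in S :\: B) row s A.
  have yE s : s \in S -> coord X y s = (s \notin B)%:R.
    move=> sS; have -> : y = \sum_(s in S :\: B) 1 *: row s A.
      by apply: eq_bigr => t _; rewrite scale1r.
    rewrite (coord_comb BS); last by move=> t; rewrite inE => /andP [].
    by rewrite inE sS andbT; case: (s \in B).
  have Cy : cone A y by apply: cone_sum => s _; exact: cone_row.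
  have Iyc : interior_cone A (y + c).
    apply: (interior_cone_shift BS Cy Cc) Tc HW => s sS sB; apply: tangent_cone_sub.
    apply: (cone_coord BS) => t tS; rewrite coordB (coord_row BS) // yE //.
    by case: (eqVneq s t) => [<-|_]; rewrite ?sB ?subrr // subr0.
  have Ly : latpt y by apply: latpt_sum => s _; exact: (latpt_row Aint).
  have := int_low (latptD Ly Lc) Iyc; rewrite mxE height_sum.
  have := congr1 (fun m => m%:R : R) (cardsID B S).
  by rewrite /= natrD (setIidPr BB) (card_basis BS); lra.
have cP : (#|P| <= d.+1)%N.
  rewrite -(ler_nat R); have := @base P (row i A) (row i A).
  rewrite mxE A1 -natr1 addrC; apply.
  - by apply/subsetP => s; rewrite inE => /andP [].
  - exact: cone_row.
  - exact: (latpt_row Aint).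
  - by apply: tangent_cone_sub; rewrite subrr; exact: cone0.
  - by move=> s _; rewrite inE => /andP [].
have cM : (#|M| <= d)%N.
  rewrite -(ler_nat R); have := @base M 0 (- row i A).
  rewrite mxE add0r; apply.
  - by apply/subsetP => s; rewrite inE => /andP [].
  - exact: cone0.
  - by move=> j; rewrite mxE rpred0.
  - by rewrite opprK; apply: tangent_cone_cone; [exact: cone0 | exact: cone_row].
  - by move=> s _; rewrite inE coordN oppr_gt0 => /andP [].
have -> : circuit i = P :|: M.
  by apply/setP => s; rewrite !inE neq_lt; case: (s \in S); rewrite //= orbC.
apply: leq_trans (leq_card_setU _ _) _; rewrite -addnn; move: cP cM.
by rewrite -addSn => *; apply: leq_add.
Qed.

Section Point.
Variable x : 'rV[R]_n.+1.
Hypothesis gx : low_interior x.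
Hypothesis x0 : forall s, s \in S -> 0 <= coord X x s.
Let Z := [set s in S | coord X x s == 0].
Let T := [set s in S | coord X x s == 1].

(** The defects [1 - x_s] are nonnegative and sum to [d]; a zero coordinate has defect 1. *)
Lemma zero_card : (#|Z| <= d)%N.
Proof.
have [Lx Ix xd] := gx.
have : \sum_(s in S) (1 - coord X x s) = d%:R.
  rewrite sumrB (coord_height A1 x BS) sumr_const (card_basis BS).
  by rewrite -xd; lra.
rewrite -(ler_nat R) => <-; rewrite -sum1_card natr_sum.
rewrite big_mkcond [leRHS]big_mkcond; apply: ler_sum => s _; rewrite inE.
case: (boolP (s \in S)) => //= sS; case: eqP => [->|_]; first by rewrite subr0.
by rewrite subr_ge0 (coord_le1 gx).
Qed.

Lemma not_one_card : (#|S :\: T| <= 3 * d)%N.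
Proof.
have [Lx _ _] := gx.
rewrite (_ : (3 * d)%N = (d + d.*2)%N); last by lia.
apply: leq_trans (leq_add zero_card (nonint_card Lx)).
apply: leq_trans (leq_card_setU _ _); apply/subset_leq_card/subsetP => s.
rewrite !inE => /andP [+ sS]; rewrite sS /= => s1; apply/norP => -[s0 /negPn].
move=> /intrP [m mE]; have := coord_le1 gx x0 sS; have := x0 sS.
rewrite mE -[1]/(1%:~R) ler0z ler_int => m0 m1.
have [e|e] : m = 0 \/ m = 1 by lia.
  by rewrite mE e eqxx in s0.
by rewrite mE e eqxx in s1.
Qed.

(** Interiority of [x] makes [- row s A] feasible; modulo the rows of [S] outside [Z] it is a conic
    combination of rows, which Caratheodory's theorem shortens to at most [#|Z|] terms. *)
Lemma neg_dir s : s \in Z -> exists (l : 'rV[R]_N) (e : R),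
  [/\ 0 < e, forall i, 0 <= l 0 i, (#|supp l| <= d)%N &
    forall t, t \in Z -> coord X (- (e *: row s A) - l *m A) t = 0].
Proof.
move=> sZ; have [_ Ix _] := gx; have sS : s \in S by move: sZ; rewrite inE => /andP [].
have [e e0 [l0 [l00 lE]]] := Ix (- row s A).
(* [M] lists the rows in coordinates, with those outside [Z] set to zero. *)
pose M := A *m X *m diag_mx (\row_t (t \in Z)%:R).
have ME (l : 'rV[R]_N) t : (l *m M) 0 t = coord X (l *m A) t * (t \in Z)%:R.
  by rewrite /M !mulmxA mul_mx_diag !mxE /coord mxE.
have Mrow t : t \in S -> t \notin Z -> row t M = 0.
  move=> tS tZ; apply/rowP => r; rewrite rowE ME -rowE (coord_row BS) // mxE.
  by case: eqP => [<-|]; rewrite ?mul0r // (negPf tZ) mulr0.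
have [l [ln lM iM]] : exists l : 'rV[R]_N, [/\ forall i, 0 <= l 0 i, l0 *m M = l *m M & indep M (supp l)].
  by apply: caratheodory; exists l0.
exists l, e; split=> // [|t tZ].
  have disj i : i \in supp l -> i \in S -> i \in Z.
    move=> il iS; apply/negPn/negP => iZ.
    have : delta_mx 0 i = 0 :> 'rV[R]_N.
      apply: iM; last by rewrite -rowE Mrow.
      by move=> j jl; rewrite mxE eqxx /=; case: eqP => // ji; rewrite ji il in jl.
    by move/rowP/(_ i); rewrite !mxE !eqxx => /eqP; rewrite oner_eq0.
  (* Rows independent modulo the span of [S :\: Z] stay independent together with it, so a dimension
     count bounds them by [#|Z|]. *)
  have iF : indep A ((S :\: Z) :|: supp l).
    move=> m ms mA.
    have mM : m *m M = 0 by rewrite /M !mulmxA mA !mul0mx.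
    have m1 : (\row_i (m 0 i * (i \in supp l)%:R)) = 0.
      apply: iM => [i /negPf il|]; first by rewrite mxE il mulr0.
      rewrite -mM !mulmx_sum_row; apply: eq_bigr => i _; rewrite mxE.
      have [il|il] := boolP (i \in supp l); first by rewrite mulr1.
      have [iSZ|iSZ] := boolP (i \in S :\: Z); last first.
        by rewrite ms ?mul0r // inE negb_or iSZ il.
      by move: iSZ; rewrite inE => /andP [iZ iS]; rewrite Mrow // !scaler0.
    have m2 i : i \notin S :\: Z -> m 0 i = 0.
      move=> iSZ; have [il|il] := boolP (i \in supp l).
        by move/rowP/(_ i): m1; rewrite !mxE il mulr1.
      by rewrite ms // inE negb_or iSZ il.
    apply/rowP => i; rewrite mxE; have [iSZ|/m2 //] := boolP (i \in S :\: Z).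
    have := coord0 X i; rewrite -mA mulmx_sum_row (bigID (mem (S :\: Z))) /=.
    rewrite [X in coord _ (_ + X)]big1 ?addr0; last by move=> j /m2 ->; rewrite scale0r.
    by rewrite (coord_comb BS) ?iSZ // => j; rewrite inE => /andP [].
  have [S' [X' [BS' FS']]] := indep_extend BS iF.
  apply: leq_trans zero_card.
  have := subset_leq_card FS'; rewrite (card_basis BS') -(card_basis BS) cardsU.
  have -> : (S :\: Z) :&: supp l = set0.
    apply/setP => i; rewrite !in_set0 in_setI in_setD; apply/negP => /andP [/andP [iZ iS] il].
    by move/negP: iZ; apply; apply: disj.
  have ZS : Z \subset S by apply/subsetP => i; rewrite inE => /andP [].
  by rewrite cards0 subn0 -(cardsID Z S) (setIidPr ZS) addnC leq_add2r.
have tS : t \in S by move: tZ; rewrite inE => /andP [].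
have := ME l t; rewrite -lM ME tZ !mulr1 -lE !coordE; move: tZ; rewrite inE => /andP [_ /eqP ->] <-.
by ring.
Qed.

(** [T'] consists of the elements of [T] avoiding the circuits of all rows used by [neg_dir]: at
    most [d] zeros, [d] rows each, [2d + 1] elements per circuit. Removing [T'] from [x] then keeps
    the other negative directions feasible. *)
Lemma apex_set_exists : exists T' : {set 'I_N},
  [/\ T' \subset T, (#|T :\: T'| <= d * (d * d.*2.+1))%N &
  forall s, s \in S :\: T' ->
    tangent_cone A (x - \sum_(t in T') row t A) (- row s A)].
Proof.
have /choice [l Hl] : forall s : 'I_N, exists l : 'rV[R]_N, s \in Z -> exists e : R,
  [/\ 0 < e, forall i, 0 <= l 0 i, (#|supp l| <= d)%N &
    forall t, t \in Z -> coord X (- (e *: row s A) - l *m A) t = 0].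
  move=> s; have [sZ|sZ] := boolP (s \in Z); last by exists 0.
  by have [l Hl] := neg_dir sZ; exists l.
pose U := \bigcup_(s in Z) \bigcup_(i in supp (l s)) circuit i.
have TS t : t \in T -> t \in S by rewrite inE => /andP [].
have T1 t : t \in T -> coord X x t = 1 by rewrite inE => /andP [_ /eqP].
have T'T t : t \in T :\: U -> t \in T by rewrite inE => /andP [].
exists (T :\: U); split; first exact: subsetDl.
  have -> : T :\: (T :\: U) = T :&: U by rewrite setDDr setDv set0U.
  apply: leq_trans (subset_leq_card (subsetIr _ _)) _.
  apply: (@leq_trans (\sum_(s in Z) d * d.*2.+1)%N); last first.
    by rewrite sum_nat_const leq_mul2r zero_card orbT.
  rewrite /U; apply: leq_trans (card_bigcup_le _ _) _.
  apply: leq_sum => s sZ; have [e [_ _ ls _]] := Hl s sZ.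
  apply: leq_trans (card_bigcup_le _ _) _.
  apply: (@leq_trans (\sum_(i in supp (l s)) d.*2.+1)%N).
    by apply: leq_sum => i _; exact: circuit_card.
  by rewrite sum_nat_const leq_mul2r ls orbT.
set xE := x - _.
have xEc t : t \in S -> coord X xE t = if t \in T :\: U then 0 else coord X x t.
  move=> tS; rewrite coordB (eq_bigr (fun t => 1 *: row t A)); last by move=> r _; rewrite scale1r.
  rewrite (coord_comb BS); last by move=> r /T'T /TS.
  by case: ifP => [/T'T/T1 ->|]; rewrite ?subrr ?subr0.
have CxE : cone A xE.
  by apply: (cone_coord BS) => t tS; rewrite xEc //; case: ifP => // _; apply: x0.
have pos t : t \in S -> t \notin T :\: U -> 0 < coord X x t -> tangent_cone A xE (- row t A).
  move=> tS tT xt; exists (coord X x t) => //; apply: (cone_coord BS) => r rS.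
  rewrite scalerN coordB coordZ (coord_row BS) // xEc //; case: (eqVneq t r) => [<-|_].
    by rewrite (negPf tT) mulr1 subrr.
  by rewrite mulr0 subr0; case: ifP => // _; apply: x0.
move=> s; rewrite in_setD => /andP [sT sS].
have := x0 sS; rewrite le_eqVlt => /orP [/eqP xs|]; last exact: pos.
have sZ : s \in Z by rewrite inE sS -xs eqxx.
have [e [e0 l0 _ lZ]] := Hl s sZ.
(* The bracketed correction vanishes on [Z] by [neg_dir] and on [T'] by the choice of [U]; elsewhere
   [x] is positive, so either sign is feasible. *)
have -> : - row s A = e^-1 *: (l s *m A + (- (e *: row s A) - l s *m A)).
  by rewrite addrC subrK scalerN scalerA mulVf ?scale1r // gt_eqF.
apply: tangent_coneZ => //; first by rewrite invr_ge0 ltW.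
have Cl : cone A (l s *m A) by exists (l s).
apply: tangent_coneD => //; first exact: tangent_cone_cone.
set v := _ - _; rewrite [v](coord_expand BS); apply: tangent_cone_sum => // t tS.
have [tZ|tZ] := boolP (t \in Z).
  by rewrite /v lZ // scale0r; apply: tangent_cone_cone => //; exact: cone0.
have [tT|tT] := boolP (t \in T :\: U).
  have -> : coord X v t = 0.
    rewrite coordB coordN coordZ (coord_row BS) //; case: (eqVneq s t) => [st|_].
      by move: tZ; rewrite -st sZ.
    rewrite mulr0 oppr0 sub0r mulmx_sum_row coord_sum big1 ?oppr0 // => i _.
    rewrite coordZ; have [->|li] := eqVneq (l s 0 i) 0; first by rewrite mul0r.
    apply/eqP; rewrite mulf_eq0; apply/orP; right; apply/negPn/negP => ci.
    move: tT; rewrite inE => /andP [/negP tU _]; apply: tU.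
    apply/bigcupP; exists s => //; apply/bigcupP; exists i; rewrite ?inE //.
    by rewrite tS.
  by rewrite scale0r; apply: tangent_cone_cone => //; exact: cone0.
have xt : 0 < coord X x t.
  by rewrite lt_neqAle x0 // andbT eq_sym; apply: contraNN tZ => /eqP e1; rewrite inE tS e1 eqxx.
have [c0|c0] := leP 0 (coord X v t).
  by apply: tangent_cone_cone => //; apply: coneZ => //; exact: cone_row.
rewrite -[coord _ _ _]opprK scaleNr -scalerN; apply: tangent_coneZ; rewrite ?oppr_ge0 ?ltW //.
exact: pos.
Qed.

Section Apex.
Variable T' : {set 'I_N}.
Hypothesis T'T : T' \subset T.
Hypothesis tangent : forall s, s \in S :\: T' ->
  tangent_cone A (x - \sum_(t in T') row t A) (- row s A).

Let T'S t : t \in T' -> t \in S.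
Proof. by move=> /(subsetP T'T); rewrite inE => /andP []. Qed.

Let T'1 t : t \in T' -> coord X x t = 1.
Proof. by move=> /(subsetP T'T); rewrite inE => /andP [_ /eqP]. Qed.

Let co_minus (B : {set 'I_N}) t : B \subset T' -> t \in S ->
  coord X (x - \sum_(r in B) row r A) t = if t \in B then 0 else coord X x t.
Proof.
move=> BT tS; rewrite coordB (eq_bigr (fun t => 1 *: row t A)); last by move=> r _; rewrite scale1r.
rewrite (coord_comb BS); last by move=> r /(subsetP BT)/T'S.
by case: ifP => [/(subsetP BT)/T'1 ->|]; rewrite ?subrr ?subr0.
Qed.

Let cone_minus (B : {set 'I_N}) : B \subset T' -> cone A (x - \sum_(r in B) row r A).
Proof.
move=> BT; apply: (cone_coord BS) => t tS; rewrite co_minus //.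
by case: ifP => // _; apply: x0.
Qed.

(** Replacement in Cayley factors: the rows of [B] in [x] may be exchanged for [c] if [c] provides a
    negative direction covering [B]. *)
Lemma apex_swap (B : {set 'I_N}) c W : B \subset T' -> cone A c -> tangent_cone A c (- W) ->
  (forall s, s \in B -> 0 < coord X W s) -> interior_cone A (x - \sum_(t in B) row t A + c).
Proof.
move=> BT Cc Tc HW.
apply: (interior_cone_shift BS (cone_minus BT) Cc) Tc _ => [s sS sB|s _]; last exact: HW.
have [sT|sT] := boolP (s \in T').
  apply: tangent_cone_sub; apply: (cone_coord BS) => t tS; rewrite coordB (coord_row BS) // co_minus //.
  case: (eqVneq s t) => [<-|_]; first by rewrite (negPf sB) T'1 // subrr.
  by rewrite subr0; case: ifP => // _; apply: x0.
have -> : x - \sum_(t in B) row t A =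
    (x - \sum_(t in T') row t A) + \sum_(t in T' :\: B) row t A.
  by rewrite [\sum_(t in T') _](big_setID B) /= (setIidPr BT) opprD addrA subrK.
rewrite -[- row s A]addr0; apply: tangent_cone_add2.
- exact: cone_minus.
- by apply: cone_sum => t _; exact: cone_row.
- by apply: tangent; rewrite inE sT.
by apply: tangent_cone_cone; [apply: cone_sum => t _; exact: cone_row | exact: cone0].
Qed.

(** Were the coordinate negative, [- row i A] would serve as [W] with [c = 0], making [x - row t A]
    interior below the least height. *)
Lemma apex_ge0 i t : t \in T' -> 0 <= coord X (row i A) t.
Proof.
move=> tT; rewrite leNgt; apply/negP => it; have [Lx Ix xd] := gx.
have := @apex_swap [set t] 0 (- row i A).
rewrite sub1set big_set1 addr0 opprK => /(_ tT (cone0 A)) H.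
have : interior_cone A (x - row t A).
  apply: H; first by apply: tangent_cone_cone; [exact: cone0 | exact: cone_row].
  by move=> s; rewrite inE => /eqP ->; rewrite coordN oppr_gt0.
move/(int_low (latptB Lx (latpt_row Aint t))).
by rewrite !mxE A1 -xd; lra.
Qed.

Variable wi : 'I_N -> 'I_N.
Variable Bn : {set 'I_N}.
Hypothesis BnT : Bn \subset T'.
Hypothesis wi0 : forall t, t \in Bn -> 0 < coord X (row (wi t) A) t.
Hypothesis wi1 : forall t, t \in Bn -> row (wi t) A != row t A.
Let dl t := row (wi t) A - row t A.

Lemma low_interior_swap (I : {set 'I_N}) : I \subset Bn -> low_interior (x + \sum_(t in I) dl t).
Proof.
move=> IB; have [Lx Ix xd] := gx; split.
- apply: latptD => //; apply: latpt_sum => t _.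
  by apply: latptB; exact: (latpt_row Aint).
- rewrite sumrB addrA addrAC; apply: (apex_swap (W := \sum_(t in I) row (wi t) A)).
  + exact: subset_trans BnT.
  + by apply: cone_sum => t _; exact: cone_row.
  + by apply: tangent_cone_sub; rewrite subrr; exact: cone0.
  + move=> s sI; rewrite coord_sum (bigD1 s) //= ltr_pwDl //; first exact: wi0 (subsetP IB _ sI).
    by apply: sumr_ge0 => t _; apply: apex_ge0; apply: (subsetP BnT); apply: (subsetP IB).
- rewrite mxE summxE big1 ?addr0 // => t _; by rewrite !mxE !A1 subrr.
Qed.

(** The shifts [dl] take at most [k] values, since distinct ones give distinct points [x + dl t];
    each value occurs fewer than [k] times, since swapping [l] elements with equal shift gives a
    progression. *)
Lemma swap_card : (#|Bn| <= k * k)%N.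
Proof.
(* A canonical representative for each value of [dl], so that its fibers are indexed by a finite
   type. *)
pose rep t := odflt t [pick u in Bn | dl u == dl t].
have repP t : t \in Bn -> rep t \in Bn /\ dl (rep t) = dl t.
  by move=> tB; rewrite /rep; case: pickP => [u /andP [uB /eqP]|/(_ t)] //; rewrite tB eqxx.
have rep_eq t u : t \in Bn -> u \in Bn -> dl t = dl u -> rep t = rep u.
  move=> tB uB e; rewrite /rep e; case: pickP => // /(_ u); by rewrite uB eqxx.
have -> : #|Bn| = (\sum_(r in rep @: Bn) #|[set t in Bn | rep t == r]|)%N.
  rewrite -sum1_card (partition_big_imset rep) /=; apply: eq_bigr => r _.
  by rewrite -sum1_card; apply: eq_bigl => t; rewrite inE.
apply: (@leq_trans (\sum_(r in rep @: Bn) k)%N); last first.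
  rewrite sum_nat_const leq_mul2r; apply/orP; right.
  rewrite cardE -(size_map (fun r => x + dl r)); apply: int_few.
    rewrite map_inj_in_uniq ?enum_uniq // => r1 r2; rewrite !mem_enum.
    move=> /imsetP [t tB ->] /imsetP [u uB ->] /addrI.
    by rewrite !(proj2 (repP _ _)) // => /rep_eq ->.
  move=> _ /mapP [r + ->]; rewrite mem_enum => /imsetP [t tB ->].
  have := @low_interior_swap [set rep t]; rewrite big_set1; apply.
  by rewrite sub1set; case: (repP t tB).
apply: leq_sum => r /imsetP [t tB ->].
set C := [set _ in _ | _].
have CE u : u \in C -> u \in Bn /\ dl u = dl t.
  rewrite inE => /andP [uB /eqP e]; split=> //.
  by rewrite -(proj2 (repP u uB)) e (proj2 (repP t tB)).
apply: ltnW; apply: (@progression_short x (dl t)).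
  by rewrite subr_eq0; exact: wi1.
move=> l lC; pose I := [set u in take l (enum C)].
have IC : I \subset C.
  by apply/subsetP => u; rewrite inE => /mem_take; rewrite mem_enum.
have Il : #|I| = l.
  have := card_uniqP (take_uniq l (enum_uniq (mem C))); rewrite size_takel -?cardE // => <-.
  by apply: eq_card => u; rewrite inE.
have -> : l%:R *: dl t = \sum_(u in I) dl u.
  rewrite (eq_bigr (fun=> dl t)); last by move=> u /(subsetP IC)/CE [].
  by rewrite sumr_const Il scaler_nat.
apply: low_interior_swap; apply/subsetP => u /(subsetP IC)/CE [] //.
Qed.

End Apex.
End Point.
End Basis.

(** The terms bound, in order, [S :\: T], [T :\: T'], the elements with a nontrivial swap, and
    [nonint_set]. *)
Definition apex_bound := (3 * d + d * (d * d.*2.+1) + k * k + 4 * d)%N.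

(** After discarding from [T'] the elements with a nontrivial swap and those with non-integral
    coordinates, each remaining row is the apex of a lattice pyramid. *)
Lemma apex_exists S0 X0 x : is_basis A S0 X0 -> low_interior x ->
  exists S X (B : {set 'I_N}), [/\ is_basis A S X, B \subset S, (#|S :\: B| <= apex_bound)%N,
    (forall a y, a \in B -> latpt y -> coord X y a \is a Num.int) &
    (forall a i, a \in B -> row i A = row a A \/ coord X (row i A) a = 0)].
Proof.
move=> BS0 gx; have [Lx Ix xd] := gx.
have [l [l0 xE iA]] := caratheodory (interior_cone_cone Ix).
have [S [X [BS sS]]] := indep_extend BS0 iA.
have x0 s : s \in S -> 0 <= coord X x s.
  by move=> sS'; rewrite xE (coord_mulmx BS).
have [T' [T'T T'card tang]] := apex_set_exists BS gx x0.
pose Bn := [set t in T' | [exists i, (row i A != row t A) && (0 < coord X (row i A) t)]].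
pose wi t := odflt t [pick i | (row i A != row t A) && (0 < coord X (row i A) t)].
have wiP t : t \in Bn -> (row (wi t) A != row t A) && (0 < coord X (row (wi t) A) t).
  rewrite inE => /andP [_ /existsP [i Hi]]; rewrite /wi; case: pickP => //= /(_ i).
  by rewrite Hi.
have Bcard : (#|Bn| <= k * k)%N.
  apply: (swap_card (wi := wi) BS gx x0 T'T tang).
  - by apply/subsetP => t; rewrite inE => /andP [].
  - by move=> t /wiP /andP [].
  - by move=> t /wiP /andP [].
exists S, X, (T' :\: Bn :\: nonint_set S X).
have T'S t : t \in T' -> t \in S by move=> /(subsetP T'T); rewrite inE => /andP [].
split=> //.
- by apply/subsetP => t; rewrite !inE => /and3P [_ _ /T'S].
- set T := [set s in S | coord X x s == 1] in T'T T'card.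
  have := not_one_card BS gx x0; rewrite -/T => c1.
  have c2 := nonint_set_card BS.
  set D := nonint_set S X in c2 *.
  have c3 := (leq_card_setU (((S :\: T) :|: (T :\: T')) :|: Bn) D).1.
  have c4 := (leq_card_setU ((S :\: T) :|: (T :\: T')) Bn).1.
  have c5 := (leq_card_setU (S :\: T) (T :\: T')).1.
  have sub : S :\: (T' :\: Bn :\: D) \subset ((S :\: T) :|: (T :\: T')) :|: Bn :|: D.
    apply/subsetP => s; rewrite !in_setU !in_setD.
    by case: (s \in T); case: (s \in T'); case: (s \in Bn); case: (s \in D); case: (s \in S).
  have c6 := subset_leq_card sub; move: c6 c5 c4 c3 c2 c1 Bcard T'card; rewrite /apex_bound.
  by clear; lia.
- move=> a y; rewrite !in_setD => /and3P [aD _ aT] Ly; apply/negPn/negP => Hy.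
  by move/negP: aD; apply; rewrite inE T'S //; apply/asboolP; exists y.
- move=> a i; rewrite !in_setD => /and3P [_ aB aT].
  have := apex_ge0 BS gx x0 T'T tang i aT; rewrite le_eqVlt => /orP [/eqP <-|i0]; first by right.
  left; apply/eqP/negPn/negP => ia; move/negP: aB; apply; rewrite inE aT.
  by apply/existsP; exists i; rewrite ia.
Qed.

End Reduction.

(** * Depth of low interior points *)

(** Pigeonhole: the fractional parts of [Q ^ #|F| + 1] multiples fall into [Q ^ #|F|] cubes, and [j]
    is a difference of two multipliers in the same cube. *)
Lemma dirichlet (R : realType) (T : finType) (F : {set T}) (y : T -> R) (Q : nat) : (0 < Q)%N ->
  exists (j : nat) (c : T -> int), [/\ (0 < j)%N, (j <= Q ^ #|F|)%N &
    forall t, t \in F -> `|j%:R * y t - (c t)%:~R| < Q%:R^-1].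
Proof.
case: Q => // Q _; pose fr (v : R) := v - (Num.floor v)%:~R.
have fr0 v : 0 <= fr v by rewrite subr_ge0 floor_le.
have fr1 v : fr v < 1 by rewrite ltrBlDr; have /andP [_] := floor_itv v; rewrite intrD addrC.
pose q v := `|Num.floor (Q.+1%:R * fr v)|%N.
have qv v : (q v)%:R <= Q.+1%:R * fr v < (q v)%:R + 1.
  have h : 0 <= Q.+1%:R * fr v by rewrite mulr_ge0.
  rewrite /q natr_absz ger0_norm ?floor_ge0 //.
  by have := floor_itv (Q.+1%:R * fr v); rewrite intrD.
have qQ v : (q v < Q.+1)%N.
  rewrite -(ltr_nat R); have /andP [h _] := qv v; apply: (le_lt_trans h).
  by rewrite gtr_pMr ?ltr0n.
pose f (i : 'I_(Q.+1 ^ #|F|).+1) : {ffun {t | t \in F} -> 'I_Q.+1} :=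
  [ffun t => Ordinal (qQ (i%:R * y (sval t)))].
have : ~~ injectiveb f.
  apply/negP => /injectiveP/leq_card; rewrite card_ord card_ffun card_ord card_sig.
  by rewrite ltnn.
move=> /injectivePn [a [b ab fab]].
wlog lt : a b ab fab / (a < b)%N.
  move=> H; case: (ltngtP a b) => [|ba|e]; first exact: H.
    by apply: (H b a) => //; rewrite eq_sym.
  by move: ab; rewrite (val_inj e) eqxx.
exists (b - a)%N, (fun t => Num.floor (b%:R * y t) - Num.floor (a%:R * y t)); split.
- by rewrite subn_gt0.
- by rewrite (leq_trans (leq_subr _ _)) // -ltnS.
move=> t tF; move/ffunP/(_ (exist _ t tF)): fab; rewrite !ffunE /= => /(congr1 val) /= e.
have := qv (b%:R * y t); have := qv (a%:R * y t); rewrite e.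
rewrite natrB ?(ltnW lt) // mulrBl intrB.
have -> : b%:R * y t - a%:R * y t - ((Num.floor (b%:R * y t))%:~R - (Num.floor (a%:R * y t))%:~R)
  = fr (b%:R * y t) - fr (a%:R * y t) by rewrite /fr; ring.
move: (fr _) (fr _) => u v /andP [v1 v2] /andP [u1 u2].
rewrite -(ltr_pM2l (ltr0Sn R Q)) divff ?pnatr_eq0 // -[X in X * _]ger0_norm ?ler0n // -normrM.
by rewrite mulrBr ltr_norml; apply/andP; split; lra.
Qed.

Section Depth.
Variables (R : realType) (N n : nat) (A : 'M[R]_(N, n.+1)).
Hypothesis A1 : forall i, A i 0 = 1.
Hypothesis Aint : forall i j, A i j \is a Num.int.
Variables d k : nat.
Hypothesis int_low : forall z, latpt z -> interior_cone A z -> n.+1%:R <= z 0 0 + d%:R.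
Hypothesis int_few : forall s, uniq s -> (forall z, z \in s -> low_interior A d z) -> (size s <= k)%N.

(** If no coordinate lay in the window [[tau, eps)], the points [x + l D] for [l <= k] would all be
    low interior: [D] is positive on coordinates below [tau] and too small to matter on those above
    [eps]. *)
Lemma scale_gap S X x (eps tau : R) (Q : nat) i0 : is_basis A S X -> low_interior A d x ->
  (forall s, s \in S -> 0 <= coord X x s) ->
  (0 < Q)%N -> eps * d.*2.+1%:R <= 1 -> k%:R <= eps * Q%:R -> tau * (k * Q ^ d.*2)%:R <= eps ->
  let Fr := [set s in S | coord X x s \isn't a Num.int] in
  i0 \in Fr -> coord X x i0 < tau ->
  exists2 s, s \in Fr & tau <= coord X x s < eps.
Proof.
move=> BS gx x0 Q0 e1 kQ tQ Fr i0F i0t; apply: contrapT => H.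
have {H} gap s : s \in Fr -> tau <= coord X x s -> eps <= coord X x s.
  by move=> sF st; rewrite leNgt; apply/negP => se; apply: H; exists s; rewrite ?st.
have [Lx Ix xd] := gx.
have k0 : (0 < k)%N.
  have := @int_few [:: x]; apply=> // z; rewrite inE => /eqP -> //.
have FrS s : s \in Fr -> s \in S by rewrite inE => /andP [].
have Frpos s : s \in Fr -> 0 < coord X x s.
  move=> sF; rewrite lt_neqAle x0 ?FrS // andbT eq_sym; apply/eqP => e.
  by move: sF; rewrite inE e rpred0 andbF.
have [j [c [j0 jQ Hc]]] := dirichlet Fr (coord X x) Q0.
have {jQ}jQ : (j <= Q ^ d.*2)%N.
  by apply: leq_trans jQ _; rewrite leq_pexp2l // (nonint_card A1 Aint int_low BS Lx).
(* Tiny coordinates are rounded down to 0 so that [D] is positive there, and integral ones cancel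
   exactly. *)
pose cR s : R := if s \in Fr then (if coord X x s < tau then 0 else (c s)%:~R) else j%:R * coord X x s.
pose D := j%:R *: x - \sum_(s in S) cR s *: row s A.
have DE s : s \in S -> coord X D s = j%:R * coord X x s - cR s.
  by move=> sS; rewrite coordB coordZ (coord_comb BS) // sS.
have LD : latpt D.
  apply: latptB; first by apply: latptZ; rewrite ?natr_int.
  apply: latpt_sum => s sS; apply: latptZ; last exact: (latpt_row Aint).
  rewrite /cR; case: ifPn => sF; first by case: ifP => _; rewrite ?rpred0 ?intr_int.
  by rewrite rpredM ?natr_int //; move: sF; rewrite inE sS negbK.
have Dout s : s \in S -> s \notin Fr -> coord X D s = 0.
  by move=> sS sF; rewrite DE // /cR (negPf sF) subrr.
have Dtiny s : s \in Fr -> coord X x s < tau -> 0 < coord X D s /\ k%:R * coord X D s < eps.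
  move=> sF st; rewrite DE ?FrS // /cR sF st subr0.
  split; first by rewrite mulr_gt0 ?ltr0n // Frpos.
  apply: lt_le_trans tQ; rewrite mulrA -natrM [ltRHS]mulrC.
  apply: (@le_lt_trans _ _ ((k * Q ^ d.*2)%:R * coord X x s)).
    by rewrite ler_wpM2r ?x0 ?FrS // ler_nat leq_mul2l jQ orbT.
  by rewrite ltr_pM2l // ltr0n muln_gt0 k0 expn_gt0 Q0.
have Dbig s : s \in Fr -> tau <= coord X x s -> k%:R * `|coord X D s| < eps.
  move=> sF st; rewrite DE ?FrS // /cR sF (le_gtF st).
  apply: (@lt_le_trans _ _ (k%:R * Q%:R^-1)); first by rewrite ltr_pM2l ?ltr0n // Hc.
  by rewrite ler_pdivrMr ?ltr0n.
have Dall s : s \in Fr -> k%:R * `|coord X D s| < eps.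
  move=> sF; case: (ltP (coord X x s) tau) => st; last exact: Dbig.
  by have [D0] := Dtiny s sF st; rewrite gtr0_norm.
have lD (l : nat) s : (l <= k)%N -> s \in Fr -> `|l%:R * coord X D s| < eps.
  move=> lk sF; apply: le_lt_trans (Dall s sF).
  by rewrite normrM normr_nat ler_wpM2r // ler_nat.
have : (k < k)%N; last by rewrite ltnn.
apply: (progression_short int_few (y := x) (D := D)).
  apply/eqP => D0; have [] := Dtiny i0 i0F i0t.
  by rewrite D0 coord0 ltxx.
move=> l lk; split; first by apply: latptD => //; apply: latptZ; rewrite ?natr_int.
  have yE s : s \in S -> coord X (x + l%:R *: D) s = coord X x s + l%:R * coord X D s.
    by move=> _; rewrite !coordE.
  have [|s|e [e0 He]] := @fin_small R 'I_N (fun s e => s \in S -> e * coord X x s <= coord X (x + l%:R *: D) s).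
  - move=> s e e' _ e'e h sS; apply: le_trans (h sS).
    by rewrite ler_wpM2r // x0.
  - have [sF|sF] := boolP (s \in Fr); last first.
      by exists 1; split=> // sS; rewrite yE // Dout // mulr0 addr0 mul1r.
    have y0 : 0 < coord X (x + l%:R *: D) s.
      rewrite yE ?FrS //; case: (ltP (coord X x s) tau) => st.
        have [D0 _] := Dtiny s sF st; rewrite ltr_pwDl ?Frpos // mulr_ge0 // ltW //.
      have := lD l s lk sF; have := gap s sF st; rewrite ltr_norml => ? /andP [? _]; lra.
    exists (coord X (x + l%:R *: D) s); split=> // sS.
    by apply: ler_piMr; [exact: ltW | exact: (coord_le1 A1 Aint int_low BS gx)].
  by apply: (interior_cone_dom BS Ix e0) => s sS; apply: He.
have DF : l%:R * D 0 0 = \sum_(s in Fr) l%:R * coord X D s.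
  rewrite -(coord_height A1 D BS) mulr_sumr big_mkcond [RHS]big_mkcond; apply: eq_bigr => s _.
  have [sF|sF] := boolP (s \in Fr); first by rewrite FrS.
  by case: ifP => // sS; rewrite Dout // mulr0.
(* The height change is an integer of absolute value below 1, so the height is unchanged. *)
have small : `|l%:R * D 0 0| < 1.
  rewrite DF; apply: le_lt_trans (ler_norm_sum _ _ _) _.
  have e0 : 0 < eps by apply: le_lt_trans (lD 0%N i0 isT i0F).
  apply: (@le_lt_trans _ _ (\sum_(s in Fr) eps)).
    by apply: ler_sum => s sF; apply: ltW; apply: lD.
  rewrite sumr_const -mulr_natr; apply: lt_le_trans e1.
  by rewrite ltr_pM2l // ltr_nat ltnS (nonint_card A1 Aint int_low BS Lx).
have : l%:R * D 0 0 \is a Num.int by rewrite rpredM ?natr_int.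
move=> /intrP [m mE]; rewrite mE in small.
have m0 : m = 0.
  by move: small; rewrite -intr_norm -[1]/(1%:~R) ltr_int; lia.
by rewrite mxE [X in x 0 0 + X]mxE mE m0 addr0.
Qed.

End Depth.

(** These parameters meet the inequalities of [scale_gap]; the factor [k.+1] keeps the denominator
    positive even for [k = 0]. *)
Definition scaleQ (R : realType) (k : nat) (eps : R) := (Num.trunc (k%:R / eps)).+1.
Definition scale_step (R : realType) (d k : nat) (eps : R) : R :=
  eps / (k.+1 * scaleQ k eps ^ d.*2)%:R.
Definition scale (R : realType) (d k m : nat) : R := iter m (scale_step d k) (d.*2.+1%:R^-1).
Definition depth (R : realType) d k : R := scale R d k d.*2.

Lemma scale_gt0 (R : realType) d k m : 0 < scale R d k m.
Proof.
elim: m => [|m IH]; first by rewrite invr_gt0 ltr0n.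
by rewrite /scale iterS divr_gt0 // ltr0n muln_gt0 expn_gt0.
Qed.

Lemma scale_decr (R : realType) d k m : scale R d k m.+1 <= scale R d k m.
Proof.
rewrite {1}/scale iterS -/(scale R d k m) /scale_step ler_pdivrMr ?ltr0n ?muln_gt0 ?expn_gt0 //.
apply: ler_peMr; first exact: ltW (scale_gt0 _ _ _ _).
by rewrite ler1n muln_gt0 expn_gt0.
Qed.

Lemma scale_le (R : realType) d k m m' : (m <= m')%N -> scale R d k m' <= scale R d k m.
Proof.
move=> /subnKC <-; elim: (m' - m)%N => [|j IH]; first by rewrite addn0.
by rewrite addnS; apply: le_trans (scale_decr _ _ _ _) IH.
Qed.

Section Depth2.
Variables (R : realType) (N n : nat) (A : 'M[R]_(N, n.+1)).
Hypothesis A1 : forall i, A i 0 = 1.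
Hypothesis Aint : forall i j, A i j \is a Num.int.
Variables d k : nat.
Hypothesis int_low : forall z, latpt z -> interior_cone A z -> n.+1%:R <= z 0 0 + d%:R.
Hypothesis int_few : forall s, uniq s -> (forall z, z \in s -> low_interior A d z) -> (size s <= k)%N.

(* At most [2d] coordinates are non-integral, so if one of them is below the last scale,
   then some window between successive scales contains no coordinate. *)
Lemma coord_depth S X x s : is_basis A S X -> low_interior A d x ->
  (forall s, s \in S -> 0 <= coord X x s) -> s \in S -> 0 < coord X x s -> depth R d k <= coord X x s.
Proof.
move=> BS gx x0 sS xs; pose Fr := [set s in S | coord X x s \isn't a Num.int].
have [Lx Ix xd] := gx.
have [sF|] := boolP (s \in Fr); last first.
  rewrite inE sS negbK => /intrP [m mE].
  have m1 : 1 <= coord X x s by move: xs; rewrite mE -[1]/(1%:~R) ltr0z ler_int; lia.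
  apply: le_trans m1; apply: le_trans (scale_le R d k (leq0n _)) _.
  by rewrite invf_le1 ?ltr0n // ler1n.
rewrite leNgt; apply/negP => sd.
pose c m := #|[set t in Fr | coord X x t < scale R d k m]|.
have Fc : (#|Fr| <= d.*2)%N := nonint_card A1 Aint int_low BS Lx.
have H m : (m <= d.*2)%N -> (c m + m <= #|Fr|)%N.
  elim: m => [_|m IH mM].
    by rewrite addn0; apply: subset_leq_card; apply/subsetP => t; rewrite inE => /andP [].
  apply: leq_trans (IH (ltnW mM)); rewrite addnS -addSn leq_add2r.
  have e0 := scale_gt0 R d k m.
  have [||||t tF /andP [t1 t2]] := @scale_gap _ _ _ _ A1 Aint _ _ int_low int_few S X x
      (scale R d k m) (scale R d k m.+1) (scaleQ k (scale R d k m)) s BS gx x0 isT _ _ _ sF.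
  - apply: (@le_trans _ _ (scale R d k 0 * d.*2.+1%:R)).
      by rewrite ler_wpM2r ?ler0n // scale_le.
    by rewrite mulVf // pnatr_eq0.
  - rewrite mulrC -ler_pdivrMr // /scaleQ; apply: ltW.
    by have /andP [] := trunc_itv (divr_ge0 (ler0n R k) (ltW e0)).
  - rewrite [scale R d k m.+1]/scale iterS -/(scale R d k m) /scale_step.
    rewrite -mulrA ler_piMr ?(ltW e0) // mulrC ler_pdivrMr ?ltr0n ?muln_gt0 ?expn_gt0 //.
    by rewrite mul1r ler_nat leq_mul2r leqnSn orbT.
  - by apply: lt_le_trans sd _; apply: scale_le.
  apply: proper_card; apply/properP; split.
    apply/subsetP => r; rewrite !inE => /andP [-> r1] /=.
    by apply: lt_le_trans r1 (scale_decr _ _ _ _).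
  by exists t; rewrite inE tF ?t2 // -leNgt.
have := H _ (leqnn _); apply/negP; rewrite -ltnNge.
apply: leq_ltn_trans Fc _; rewrite -[X in (X < _)%N]add0n ltn_add2r.
by apply/card_gt0P; exists s; rewrite inE sF.
Qed.

Definition depthL := (Num.trunc (2 / depth R d k)).+1.

(** Interiority lets [x] use [a_v] with positive weight, and Caratheodory's theorem retaining [v]
    gives a basis in which the coordinate of [x] at [v] is at least the depth. As [L] exceeds its
    inverse, some positive multiple of [x] is left over. *)
Lemma vertex_depth S0 X0 x v : is_basis A S0 X0 -> low_interior A d x ->
  interior_cone A (x - depthL%:R^-1 *: row v A).
Proof.
move=> BS0 gx; have [Lx Ix xd] := gx.
have [e e0 [l [l0 lE]]] := Ix (- row v A).
have xE : x = (l + e *: delta_mx 0 v) *m A.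
  by rewrite mulmxDl -lE -scalemxAl -rowE scalerN subrK.
have [||l' [l'0 l'E l'v iA]] := caratheodory_pos A1 (l := l + e *: delta_mx 0 v) (v := v).
- by move=> i; rewrite !mxE addr_ge0 // mulr_ge0 ?ler0n // ltW.
- by rewrite !mxE !eqxx mulr1 ltr_wpDl.
rewrite -xE in l'E.
have [S [X [BS sS]]] := indep_extend BS0 iA.
have coordE' s : s \in S -> coord X x s = l' 0 s.
  by move=> sS'; rewrite l'E (coord_mulmx BS).
have vS : v \in S by apply: (subsetP sS); rewrite inE gt_eqF.
have dv : depth R d k <= coord X x v.
  by apply: (coord_depth BS gx) => // [s sS'|]; rewrite coordE'.
set dl := depth R d k in dv *.
have dl0 : 0 < dl by exact: scale_gt0.
have L2 : 2 / dl < depthL%:R.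
  by have /andP [] := trunc_itv (divr_ge0 (ler0n R 2) (ltW dl0)).
have L0 : 0 < depthL%:R :> R by rewrite ltr0n.
pose t := (depthL%:R * dl)^-1.
have t1 : t < 1.
  rewrite invf_lt1 ?mulr_gt0 // -ltr_pdivrMr // mul1r; apply: lt_trans L2.
  by rewrite ltr_pdivlMr // mulVf ?gt_eqF // ltr1n.
have -> : x - depthL%:R^-1 *: row v A = (1 - t) *: x + t *: (x - dl *: row v A).
  rewrite scalerBr addrA -scalerDl subrK scale1r scalerA /t invfM -mulrA mulVf ?mulr1 //.
  by rewrite gt_eqF.
apply: interior_coneD; first by apply: interior_coneZ => //; rewrite subr_gt0.
apply: coneZ; first by rewrite invr_ge0 mulr_ge0 // ltW.
apply: (cone_coord BS) => s sS'; rewrite coordB coordZ (coord_row BS) //.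
case: (eqVneq v s) => [<-|_]; first by rewrite mulr1 subr_ge0.
by rewrite mulr0 subr0 coordE'.
Qed.

End Depth2.

(** * Counting lattice points and the volume *)

Lemma card_fibers_le (T U : finType) (f : T -> U) (k : nat) :
  (forall u, (#|[set t | f t == u]| <= k)%N) -> (#|T| <= k * #|U|)%N.
Proof.
move=> H; rewrite mulnC -sum_nat_const -sum1_card (partition_big f predT) //=.
apply: leq_sum => u _; apply: leq_trans (H u).
by rewrite -sum1_card; apply: eq_leq; apply: eq_bigl => t; rewrite inE.
Qed.

Section ApexCount.
Variables (R : realType) (N n : nat) (A : 'M[R]_(N, n.+1)).
Hypothesis A1 : forall i, A i 0 = 1.
Hypothesis Aint : forall i j, A i j \is a Num.int.
Variables d k L : nat.
Hypothesis L0 : (0 < L)%N.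
Hypothesis int_few : forall s, uniq s -> (forall z, z \in s -> low_interior A d z) -> (size s <= k)%N.
Variables (S B : {set 'I_N}) (X : 'M[R]_(n.+1, N)) (s0 : 'I_N) (x : 'rV[R]_n.+1).
Hypothesis BS : is_basis A S X.
Hypothesis BsubS : B \subset S.
Hypothesis s0S : s0 \in S.
Hypothesis s0B : s0 \notin B.
Hypothesis Bint : forall a y, a \in B -> latpt y -> coord X y a \is a Num.int.
Hypothesis gx : low_interior A d x.
Hypothesis xdeep : forall v, interior_cone A (x - L%:R^-1 *: row v A).

(** An average of the points [x - a_i / L] with the weights of [z]; [h + 1] instead of [h] leaves
    the share [x / (h + 1)], which makes the result interior. *)
Lemma interior_cone_sub_scaled z (h : nat) : cone A z -> z 0 0 = h%:R ->
  interior_cone A (x - (L * h.+1)%:R^-1 *: z).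
Proof.
move=> [l [l0 zE]] zh; have [_ Ix _] := gx.
have lh : \sum_i l 0 i = h%:R.
  by rewrite -zh zE mxE; apply: eq_bigr => i _; rewrite A1 mulr1.
have -> : x - (L * h.+1)%:R^-1 *: z =
    h.+1%:R^-1 *: x + \sum_i (l 0 i / h.+1%:R) *: (x - L%:R^-1 *: row i A).
  under eq_bigr do rewrite scalerBr.
  rewrite sumrB -scaler_suml -mulr_suml lh addrA -scalerDl.
  have -> : h.+1%:R^-1 + h%:R / h.+1%:R = 1 :> R.
    by rewrite -{1}[h.+1%:R^-1]mul1r -mulrDl -natr1 [1 + _]addrC divff // natr1 pnatr_eq0.
  rewrite scale1r zE mulmx_sum_row scaler_sumr; congr (_ - _); apply: eq_bigr => i _.
  by rewrite !scalerA natrM invfM; congr (_ *: _); ring.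
apply: interior_coneD; first by apply: interior_coneZ; rewrite ?invr_gt0 ?ltr0n.
apply: cone_sum => i _; apply: coneZ; first by rewrite divr_ge0.
exact: interior_cone_cone.
Qed.

(* Lattice points of the slice that are congruent modulo [L (h + 1)] differ by
   multiples that can be added to [x] without leaving the interior; the coordinates
   along [B] are free, which accounts for the exponent. *)
Lemma apex_count (Y : seq 'rV[R]_n.+1) (h : nat) : uniq Y ->
  (forall z, z \in Y -> [/\ latpt z, cone A z, z 0 0 = h%:R &
     forall a, a \in B -> coord X z a = 0]) ->
  (size Y <= k * (L * h.+1) ^ (n - #|B|))%N.
Proof.
move=> uY HY; set q := (L * h.+1)%N.
have q0 : (0 < q)%N by rewrite muln_gt0 L0.
have qR : q%:R != 0 :> R by rewrite pnatr_eq0 -lt0n.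
have qZ : q%:Z != 0 by rewrite -lt0n.
have res (m : int) : (`|(m %% q%:Z)%Z|%N < q)%N.
  by rewrite -ltz_nat gez0_abs ?modz_ge0 // ltz_pmod.
pose z (i : 'I_(size Y)) := nth 0 Y i.
have zY i : z i \in Y by apply: mem_nth.
(* The added differences keep the height and realize every residue vector along [B]. *)
pose pt (p : 'I_(size Y) * {ffun {a | a \in B} -> 'I_q}) :=
  z p.1 + \sum_a (p.2 a)%:R *: (row (sval a) A - row s0 A).
have Lpt p : latpt (pt p).
  apply: latptD; first by case: (HY _ (zY p.1)).
  apply: latpt_sum => a _; apply: latptZ; rewrite ?natr_int //.
  by apply: latptB; exact: (latpt_row Aint).
have hpt p : pt p 0 0 = h%:R.
  rewrite mxE summxE big1 ?addr0; first by case: (HY _ (zY p.1)).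
  by move=> a _; rewrite !mxE !A1 subrr mulr0.
have cpt p b : coord X (pt p) (sval b) = (p.2 b)%:R.
  have bB := valP b; have bS := subsetP BsubS _ bB.
  have s0b : (s0 == sval b) = false by apply: contraNF s0B => /eqP ->.
  rewrite coordD; case: (HY _ (zY p.1)) => _ _ _ ->; rewrite // add0r coord_sum (bigD1 b) //=.
  rewrite coordZ coordB !(coord_row BS) // eqxx s0b subr0 mulr1 big1 ?addr0 // => a ab.
  rewrite coordZ coordB !(coord_row BS) ?(subsetP BsubS _ (valP a)) // s0b.
  by rewrite (_ : (sval a == sval b) = false) ?subrr ?mulr0 //; apply: negbTE.
(* The height is fixed, so [n] residues decide congruence modulo [q]. *)
pose f p : {ffun 'I_n -> 'I_q} := [ffun j => Ordinal (res (Num.floor (pt p 0 (lift 0 j))))].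
have fdiff p p' : f p = f p' -> latpt (q%:R^-1 *: (pt p - pt p')).
  move=> fp j; rewrite mxE [X in _ * X]mxE [X in _ * (_ + X)]mxE.
  case: (unliftP 0 j) => [j' ->|->]; last by rewrite !hpt subrr mulr0 rpred0.
  move/ffunP/(_ j'): fp; rewrite !ffunE => /(congr1 val) /=.
  have := floorK (Lpt p' (lift 0 j')); have := floorK (Lpt p (lift 0 j')).
  set a := Num.floor (pt p _ _); set b := Num.floor (pt p' _ _) => <- <- e.
  have {}e : (a = b %[mod q%:Z])%Z.
    apply/eqP; rewrite -[X in X == _]gez0_abs ?modz_ge0 // -[X in _ == X]gez0_abs ?modz_ge0 //.
    by rewrite e.
  have /dvdzP [c cE] : (q%:Z %| a - b)%Z by rewrite -eqz_mod_dvd; apply/eqP.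
  by rewrite -intrB cE intrM mulrC -mulrA divff // mulr1 intr_int.
(* Coordinates along [B] are integral on lattice points, so congruent points have equal residues
   there. *)
have ftau p p' : f p = f p' -> p.2 = p'.2.
  move=> fp; apply/ffunP => b; apply: val_inj.
  have := Bint (valP b) (fdiff _ _ fp); rewrite coordZ coordB !cpt => /intrP [m mE].
  have {}mE : (p.2 b)%:Z - (p'.2 b)%:Z = q%:Z * m.
    apply/eqP; rewrite -(eqr_int R) intrB intrM -mE mulrA divff // mul1r.
    by [].
  have := ltn_ord (p.2 b); have := ltn_ord (p'.2 b); move: mE; set u := nat_of_ord _; set v := nat_of_ord _.
  move=> mE uq vq; have m0 : m = 0 by nia.
  rewrite -[LHS]/u -[RHS]/v; move: mE; rewrite m0 mulr0; lia.
have fib u : (#|[set p | f p == u]| <= k)%N.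
  have [->|[p0]] := set_0Vmem [set p | f p == u]; first by rewrite cards0.
  rewrite inE => /eqP fp0.
  rewrite cardE -(size_map (fun p => x + q%:R^-1 *: (z p.1 - z p0.1))).
  have same p : f p == u -> p.2 = p0.2 by move/eqP => e; apply: ftau; rewrite e fp0.
  apply: int_few.
    rewrite map_inj_in_uniq ?enum_uniq // => p p'; rewrite !mem_enum !inE => fp fp'.
    move=> /addrI /(scalerI (invr_neq0 qR)) /addIr /eqP; rewrite /z nth_uniq // => /eqP/val_inj e.
    have := same p' fp'; rewrite -(same p fp); move: e; case: (p) (p') => p1 p2 [p1' p2'] /= -> ->.
    by [].
  move=> _ /mapP [p + ->]; rewrite mem_enum inE => fp.
  have := fdiff p p0; rewrite (eqP fp) fp0 => /(_ erefl).
  have -> : pt p - pt p0 = z p.1 - z p0.1 by rewrite /pt (same p fp) opprD addrACA subrr addr0.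
  have [Lz Cz zh _] := HY _ (zY p.1); have [Lz0 Cz0 zh0 _] := HY _ (zY p0.1).
  move=> Lg; have [Lx Ix xd] := gx; split.
  - exact: latptD.
  - rewrite scalerBr addrCA [X in interior_cone _ X]addrC; apply: interior_coneD; last first.
      by apply: coneZ => //; rewrite invr_ge0.
    exact: interior_cone_sub_scaled.
  - by rewrite !mxE zh zh0 subrr mulr0 addr0.
have := card_fibers_le fib.
rewrite card_prod !card_ffun !card_ord card_sig => le.
have Bn : (#|B| <= n)%N.
  have := subset_leq_card (_ : s0 |: B \subset S); rewrite cardsU1 s0B (card_basis BS) add1n ltnS.
  by apply; rewrite subUset sub1set s0S.
have qE : (q ^ n = q ^ (n - #|B|) * q ^ #|B|)%N by rewrite -expnD subnK.
by move: le; rewrite qE mulnA leq_pmul2r // expn_gt0 q0.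
Qed.

End ApexCount.

(** * Backward differences, binomial growth and the volume limit *)

Lemma iter_bdiffE p f i :
  iter p bdiff f i = \sum_(j < i.+1) (-1) ^+ j * ('C(p, j))%:Z * f (i - j)%N.
Proof.
elim: p i => [|p IH] i /=.
  rewrite big_ord_recl /= expr0 bin0 !mul1r subn0 big1 ?addr0 // => j _.
  by rewrite bin0n mulr0 mul0r.
rewrite /bdiff IH big_ord_recl [RHS]big_ord_recl /= !bin0 -addrA; congr (_ + _).
case: i => [|i]; first by rewrite !big_ord0 subrr.
rewrite IH -sumrB; apply: eq_bigr => j _; rewrite /bump /= add1n subSS binS exprS PoszD.
by ring.
Qed.

(** Summation undoes a difference, and Pascal's rule raises the degree of the binomial bound by one
    each time. *)
Lemma iter_bdiff_le p r f (b : nat) :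
  (forall m, iter p bdiff f m <= (b * 'C(m + r, r))%:Z) ->
  forall m, f m <= (b * 'C(m + (p + r), p + r))%:Z.
Proof.
elim: p f => // p IH f H m.
have {H} H := IH (bdiff f) (fun m => ltac:(by rewrite -iterSr; exact: H)).
elim: m => [|m IHm].
  by have := H 0%N; rewrite /bdiff subr0 !add0n !binn.
have := lerD (H m.+1) IHm; rewrite [bdiff _ _]/bdiff subrK => /le_trans; apply.
by rewrite -PoszD lez_nat -mulnDr addSn !addnS addSn binS leq_mul2l addnC leqnn orbT.
Qed.

Lemma bdiff_sum f m : f m = \sum_(i < m.+1) bdiff f i.
Proof.
elim: m => [|m IH]; first by rewrite big_ord1 /bdiff subr0.
by rewrite big_ord_recr /= -IH /bdiff addrC subrK.
Qed.

(** [n! f(m) / m^n] is at most [b (1 + n/m)^n], which tends to [b]. *)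
Lemma volume_bound (R : realType) n (f : nat -> nat) (b : nat) (vol : R) :
  (forall m, (f m <= b * 'C(m + n, n))%N) ->
  (forall eps : R, 0 < eps -> exists M : nat, forall m : nat, (M <= m)%N ->
    `| (n`!)%:R * (f m)%:R / (m%:R ^+ n) - vol | < eps) ->
  vol <= b%:R.
Proof.
move=> fb Hv; rewrite leNgt; apply/negP => bv.
pose eps := (vol - b%:R) / 2.
have e0 : 0 < eps by rewrite divr_gt0 // subr_gt0.
have [M HM] := Hv eps e0.
(* The chord bound for a convex function on [[0, 1]]. *)
have expn1 (t : R) : 0 <= t -> t <= 1 -> (1 + t) ^+ n <= 1 + (2 ^+ n - 1) * t.
  move=> t0 t1; elim: n {fb Hv HM} => [|p IH]; first by rewrite !expr0 subrr mul0r addr0.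
  have P1 : 1 <= 2 ^+ p :> R by rewrite exprn_ege1 // ler1n.
  rewrite exprS; apply: (@le_trans _ _ ((1 + t) * (1 + (2 ^+ p - 1) * t))).
    by rewrite ler_wpM2l // addr_ge0.
  have : 0 <= (2 ^+ p - 1) * (t * (1 - t)).
    by rewrite mulr_ge0 ?subr_ge0 // mulr_ge0 // subr_ge0.
  by rewrite exprS; move: (2 ^+ p) => c; lra.
(* For [m > K] the error term is at most [eps], half of the supposed gap. *)
pose K := (n%:R * (b%:R * 2 ^+ n) / eps : R).
pose m := maxn (maxn M n.+1) (Num.trunc K).+1.
have Mm : (M <= m)%N by rewrite /m !leq_max leqnn.
have nm : (n < m)%N by rewrite /m !leq_max leqnn orbT.
have Km : K < m%:R.
  apply: (@lt_le_trans _ _ (Num.trunc K).+1%:R); last by rewrite ler_nat /m leq_maxr.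
  have K0 : 0 <= K.
    by apply: divr_ge0; [do 2![apply: mulr_ge0 => //]; exact: exprn_ge0 | exact: ltW].
  by have /andP [] := trunc_itv K0.
have m0 : 0 < m%:R :> R by rewrite ltr0n; apply: leq_ltn_trans nm.
have := HM m Mm; rewrite ltr_norml => /andP [+ _].
apply/negP; rewrite -leNgt.
have fact_le : (n`! * 'C(m + n, n) <= (m + n) ^ n)%N.
  rewrite mulnC bin_ffact.
  have : forall p j, (p ^_ j <= p ^ j)%N.
    move=> p; elim=> [|j IH]; first by rewrite ffactn0.
    rewrite ffactnSr expnSr; apply: leq_mul => //; exact: leq_subr.
  exact.
have : n`!%:R * (f m)%:R / m%:R ^+ n <= b%:R * (1 + n%:R / m%:R) ^+ n :> R.
  have -> : 1 + n%:R / m%:R = (m + n)%:R / m%:R :> R.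
    by rewrite natrD mulrDl divff ?gt_eqF.
  rewrite expr_div_n mulrA ler_pM2r ?invr_gt0 ?exprn_gt0 //.
  rewrite -natrX -!natrM ler_nat; apply: leq_trans (leq_mul (leqnn b) fact_le).
  by rewrite mulnCA leq_mul2l fb orbT.
have t1 : n%:R / m%:R <= 1 :> R by rewrite ler_pdivrMr // mul1r ler_nat ltnW.
have t0 : 0 <= n%:R / m%:R :> R by rewrite divr_ge0.
have h1 := expn1 _ t0 t1.
have h2 : b%:R * (1 + n%:R / m%:R) ^+ n <= b%:R * (1 + (2 ^+ n - 1) * (n%:R / m%:R)) :> R.
  by rewrite ler_wpM2l.
have h3 : b%:R * 2 ^+ n * (n%:R / m%:R) <= eps :> R.
  move: Km; rewrite /K ltr_pdivrMr // => Km.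
  by rewrite mulrA ler_pdivrMr // ltW // mulrC [ltRHS]mulrC.
have h4 : b%:R * (1 + (2 ^+ n - 1) * (n%:R / m%:R)) <= b%:R + b%:R * 2 ^+ n * (n%:R / m%:R) :> R.
  rewrite mulrDr mulr1 lerD2l mulrA ler_wpM2r // mulrBr mulr1 lerBlDr lerDl ler0n //.
rewrite /eps in h3 *; lra.
Qed.

Lemma basis_exists (R : realType) N p (A : 'M[R]_(N, p)) : row_full A ->
  exists S X, is_basis A S X.
Proof.
move=> fA; pose f := fullrankfun fA; pose P : 'M[R]_(p, N) := \matrix_(i, j) (f i == j)%:R.
have PA : P *m A = rowsub f A.
  apply/row_matrixP => i; rewrite row_mul row_rowsub [RHS]rowE; congr (_ *m _).
  by apply/rowP => j; rewrite !mxE eqxx eq_sym.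
exists [set f i | i : 'I_p], (invmx (rowsub f A) *m P); split.
- by rewrite -mulmxA PA mulVmx // fullrowsub_unit.
- move=> i iS j; rewrite mxE big1 // => r _; rewrite mxE.
  by case: eqP => [e|]; rewrite ?mulr0 //; case/negP: iS; apply/imsetP; exists r.
- move=> _ /imsetP [i _ ->]; rewrite mulmxA -row_rowsub -row_mul mulmxV ?fullrowsub_unit //.
  by rewrite row1 -rowE; apply/rowP => j; rewrite !mxE eqxx eq_sym.
Qed.

(** Both kinds of genericity say that finitely many linear forms in [w] do not vanish; [c] lists
    their coefficient vectors, each having entry 1 at [i]. *)
Lemma generic_weight (R : realType) N n (A : 'M[R]_(N, n.+1)) :
  exists w : 'rV[R]_N, [/\ forall i, 0 < w 0 i,
    forall (S : {set 'I_N}) i, basisb A S -> i \notin S -> dual A w S (row i A) != w 0 i &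
    regular_dir A (w *m A)].
Proof.
pose c (t : {set 'I_N} * 'I_N) : 'rV[R]_N := let: (E, i) := t in
  if basisb A E then
    (if i \in E then (col i (A *m coordmx A E))^T else delta_mx 0 i - row i A *m coordmx A E)
  else delta_mx 0 i.
have cn t : c t != 0.
  case: t => S i /=; apply/rV0Pn; exists i; case: ifP => [/coordmxP BS|_]; last first.
    by rewrite mxE !eqxx oner_eq0.
  case: ifPn => iS.
    have -> : (col i (A *m coordmx A S))^T 0 i = coord (coordmx A S) (row i A) i.
      by rewrite 2!mxE /coord -row_mul [RHS]mxE.
    by rewrite (coord_row BS) // eqxx oner_eq0.
  have -> : (delta_mx 0 i - row i A *m coordmx A S) 0 i = 1 - coord (coordmx A S) (row i A) i.
    by rewrite /coord !mxE !eqxx.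
  by rewrite (coord_out BS) // subr0 oner_eq0.
have [w [w0 Hw]] := generic_moment cn.
exists w; split=> // [S i bS iS|S s bS sS].
  have := Hw (S, i); rewrite /c bS (negPf iS); apply: contra_neq => e.
  under eq_bigr => j _ do rewrite mxE mulrDl.
  rewrite big_split /= (bigD1 i) //= big1 ?addr0 => [|j ji]; last first.
    by rewrite mxE (negPf ji) andbF mul0r.
  rewrite mxE !eqxx mul1r -e /dual big_mkcond -big_split big1 //= => j _.
  rewrite mxE -[(row i A *m coordmx A S) 0 j]/(coord (coordmx A S) (row i A) j) mulNr.
  by case: ifPn => jS; rewrite ?subrr // (coord_out (coordmxP bS)) // mul0r oppr0 addr0.
have := Hw (S, s); rewrite /c bS sS; apply: contra_neq => e.
rewrite -[RHS]e /coord -mulmxA mxE; apply: eq_bigr => j _.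
by rewrite mulrC 2!mxE.
Qed.

(** * From the polytope to the cone over it *)

Section Bridge.
Variables (R : realType) (n : nat) (V : seq 'rV[int]_n).
Let N := size V.

Definition homog_mx : 'M[R]_(N, n.+1) :=
  \matrix_(i, j) if unlift ord0 j is Some j' then ((nth 0 V i) 0 j')%:~R else 1.

Definition homog_pt (m : nat) (x : 'rV[int]_n) : 'rV[R]_n.+1 :=
  \row_j if unlift ord0 j is Some j' then (x 0 j')%:~R else m%:R.

Lemma homog_mx1 i : homog_mx i 0 = 1.
Proof. by rewrite mxE unlift_none. Qed.

Lemma homog_mx_int i j : homog_mx i j \is a Num.int.
Proof. by rewrite mxE; case: unliftP => [j' _|_]; rewrite ?intr_int ?rpred1. Qed.

Lemma homog_pt0 m x : homog_pt m x 0 0 = m%:R.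
Proof. by rewrite mxE unlift_none. Qed.

Lemma homog_ptS m x j : homog_pt m x 0 (lift 0 j) = (x 0 j)%:~R.
Proof. by rewrite mxE liftK. Qed.

Lemma in_dilateE m x : in_dilate R V m x <-> cone homog_mx (homog_pt m x).
Proof.
have hS i j : homog_mx i (lift 0 j) = ((nth 0 V i) 0 j)%:~R by rewrite mxE liftK.
split.
  move=> [lam [l0 [lm lx]]]; exists (\row_i lam i); split=> [i|]; first by rewrite mxE.
  apply/rowP => j; rewrite [RHS]mxE; case: (unliftP 0 j) => [j' ->|->].
    by rewrite homog_ptS lx; apply: eq_bigr => i _; rewrite hS mxE.
  by rewrite homog_pt0 -lm; apply: eq_bigr => i _; rewrite homog_mx1 mulr1 mxE.
move=> [l [l0 e]]; exists (l 0); split=> //; split.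
  by rewrite -(homog_pt0 m x) e mxE; apply: eq_bigr => i _; rewrite homog_mx1 mulr1.
by move=> j; rewrite -(homog_ptS m x) e mxE; apply: eq_bigr => i _; rewrite hS.
Qed.

(** Ensures that the finite box in [ehrhart] misses no lattice point of the dilate. *)
Lemma cone_box m x j : cone homog_mx (homog_pt m x) -> (`|x 0%R j| <= m * coord_bound V)%N.
Proof.
move=> /in_dilateE [lam [l0 [lm lx]]].
rewrite -(ler_nat R) natr_absz intr_norm lx.
apply: le_trans (ler_norm_sum _ _ _) _; rewrite natrM -lm mulr_suml; apply: ler_sum => i _.
rewrite normrM ger0_norm // ler_wpM2l // -intr_norm -natr_absz ler_nat.
apply: (@leq_trans (\max_(j < n) `|(nth 0%R V i) 0%R j|)%N).
  exact: (leq_bigmax (F := fun j => `|(nth 0%R V i) 0%R j|%N)).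
by apply: (leq_bigmax_seq (F := fun v : 'rV[int]_n => \max_(j < n) `|v 0%R j|%N)) => //; exact: mem_nth.
Qed.

Definition slice_pts (m : nat) : seq 'rV[R]_n.+1 :=
  [seq homog_pt m (box_point c) | c : {ffun 'I_n -> 'I_((m * coord_bound V).*2.+1)} <-
     enum [set c : {ffun 'I_n -> 'I_((m * coord_bound V).*2.+1)} |
            `[< in_dilate R V m (box_point c) >] ]].

Lemma size_slice_pts m : size (slice_pts m) = ehrhart R V m.
Proof. by rewrite size_map -cardE. Qed.

Lemma slice_pts_uniq m : uniq (slice_pts m).
Proof.
rewrite map_inj_uniq ?enum_uniq // => c c' e; apply/ffunP => j; apply: val_inj.
move/rowP/(_ (lift 0 j)): e; rewrite !homog_ptS !mxE => /eqP; rewrite eqr_int => /eqP /=.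
by move/addIr => [].
Qed.

Lemma slice_ptsP m z : reflect [/\ latpt z, cone homog_mx z & z 0 0 = m%:R] (z \in slice_pts m).
Proof.
apply: (iffP mapP) => [[c]|[Lz Cz zm]].
  rewrite mem_enum inE => /asboolP /in_dilateE Cc ->; split=> //; last exact: homog_pt0.
  by move=> j; rewrite mxE; case: unliftP => [j' _|_]; rewrite ?intr_int ?natr_int.
pose x : 'rV[int]_n := \row_j Num.floor (z 0 (lift 0 j)).
have zE : z = homog_pt m x.
  apply/rowP => j; case: (unliftP 0 j) => [j' ->|->]; last by rewrite homog_pt0.
  by rewrite homog_ptS mxE floorK.
rewrite zE in Cz; set M := (m * coord_bound V)%N.
have xM j : (`|(x 0 j + M%:Z)%R|%N < M.*2.+1)%N /\ 0 <= x 0 j + M%:Z.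
  by have := cone_box j Cz; rewrite -/M; move: (x 0 j) => a; lia.
have xE : x = box_point [ffun j => Ordinal (proj1 (xM j))].
  by apply/rowP => j; rewrite [RHS]mxE ffunE /= gez0_abs ?(proj2 (xM j)) // addrK.
exists [ffun j => Ordinal (proj1 (xM j))]; last by rewrite -xE.
by rewrite mem_enum inE; apply/asboolP/in_dilateE; rewrite -xE.
Qed.

(** An affine form vanishing on all vertices has zero linear part, by the rank condition on
    differences, and then zero constant term. *)
Lemma full_dim_homog_mx : full_dim R V -> row_full homog_mx.
Proof.
case=> Vn; set M := \matrix_(i, j) _ => rM.
have N0 : (0 < size V)%N by case: (V) Vn.
suff : row_free homog_mx^T by rewrite /row_free /row_full mxrank_tr.
apply: inj_row_free => v vA.
have vE (i : 'I_(size V)) : v 0 0 + \sum_j v 0 (lift 0 j) * ((nth 0 V i) 0 j)%:~R = 0 :> R.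
  move/rowP: vA => /(_ i); rewrite !mxE big_ord_recl mxE homog_mx1 mulr1 => e.
  rewrite -[RHS]e; congr (_ + _); apply: eq_bigr => j _.
  by rewrite !mxE liftK.
pose v' := \row_j v 0 (lift 0 j).
have v'0 : v' = 0.
  apply/eqP; rewrite -(@mulmx_free_eq0 _ _ _ _ v' M^T); last by rewrite /row_free mxrank_tr rM.
  apply/eqP/rowP => i; rewrite !mxE.
  have := vE i; have := vE (Ordinal N0) => /= e0 ei.
  have e : (v 0 0 + \sum_j v 0 (lift 0 j) * ((nth 0 V i) 0 j)%:~R) -
      (v 0 0 + \sum_j v 0 (lift 0 j) * ((nth 0 V 0) 0 j)%:~R) = 0 by rewrite e0 ei subrr.
  rewrite -[RHS]e opprD addrACA subrr add0r -sumrB; apply: eq_bigr => j _.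
  by rewrite !mxE intrB mulrBr.
have v'S j : v 0 (lift 0 j) = 0 by move/rowP/(_ j): v'0; rewrite !mxE.
apply/rowP => j; rewrite [RHS]mxE; case: (unliftP 0 j) => [j' ->|->]; first exact: v'S.
have := vE (Ordinal N0); rewrite big1 ?addr0 // => j' _.
by rewrite v'S mul0r.
Qed.

Lemma hstarE i : hstar R V i = iter n.+1 bdiff (fun m => (size (slice_pts m))%:Z) i.
Proof.
by rewrite iter_bdiffE; apply: eq_bigr => j _; rewrite size_slice_pts.
Qed.

End Bridge.

(** * The bounds on the h*-coefficients and on the volume *)

Definition hstar_bound (R : realType) (d k i : nat) : nat :=
  (k * (depthL R d k * i.+1) ^ apex_bound d k)%N.

Lemma hstar_le (R : realType) n (V : seq 'rV[int]_n) (d k : nat) : (0 < k)%N ->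
  full_dim R V -> hstar_deg_lead R V d k%:Z ->
  forall i, hstar R V i <= (hstar_bound R d k i)%:Z.
Proof.
move=> k0 fV [hk [_ hd]] i.
have [S0 [X0 BS0]] := basis_exists (full_dim_homog_mx fV).
set A := homog_mx R V in BS0.
have A1 := @homog_mx1 R n V : forall i, A i 0 = 1.
have Aint := @homog_mx_int R n V : forall i j, A i j \is a Num.int.
have [w [w0 wgen qreg]] := generic_weight A.
have bS0 := basisbE BS0.
have pu := @slice_pts_uniq R n V; have pP := @slice_ptsP R n V.
have hd' j : (d < j)%N -> iter n.+1 bdiff (fun m => (size (slice_pts R V m))%:Z) j = 0.
  by move=> /hd; rewrite hstarE.
rewrite hstarE in hk.
have low := int_height A1 Aint w0 wgen qreg bS0 pu pP hd'.
have few := int_count A1 Aint w0 wgen qreg bS0 pu pP hd' hk.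
have [x gx] := int_exists A1 Aint w0 wgen qreg bS0 pu pP hk k0.
have [S [X [B [BS BsubS Bcard Bint BV]]]] := apex_exists A1 Aint low few BS0 gx.
have [s0 s0S] : exists s0, s0 \in S by apply/set0Pn; rewrite -card_gt0 (card_basis BS).
(* [apex_count] uses a basis element outside the apices; dropping [s0] costs nothing in the end, as
   the exponent counts from [n] and not from [n + 1]. *)
have B'B : B :\ s0 \subset B by apply: subsetDl.
have deep v := vertex_depth A1 Aint low few v BS0 gx.
have B'int a y : a \in B :\ s0 -> latpt y -> coord X y a \is a Num.int.
  by move/(subsetP B'B); apply: Bint.
have B'V a j : a \in B :\ s0 -> row j A = row a A \/ coord X (row j A) a = 0.
  by move/(subsetP B'B); apply: BV.
rewrite hstarE; apply: le_trans (hstar_le_apex A1 Aint w0 wgen qreg bS0 pu pP i BS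
  (subset_trans B'B BsubS) B'int B'V) _.
rewrite lez_nat -size_filter.
apply: leq_trans (apex_count A1 Aint (isT : (0 < depthL R d k)%N) few BS
  (subset_trans B'B BsubS) s0S _ B'int gx deep (h := i) (filter_uniq _ (pu i)) _) _.
- by rewrite !inE eqxx.
- move=> z; rewrite mem_filter => /andP [/forall_inP H /pP [Lz Cz zi]].
  by split=> // a aB; apply/eqP; apply: H.
rewrite /hstar_bound leq_mul2l; apply/orP; right; rewrite leq_pexp2l ?muln_gt0 //.
have cS := card_basis BS.
have c1 := cardsID (B :\ s0) S; rewrite (setIidPr (subset_trans B'B BsubS)) cS in c1.
have c2 : (#|S :\: (B :\ s0)| <= #|S :\: B| .+1)%N.
  apply: leq_trans (subset_leq_card (_ : _ \subset s0 |: (S :\: B))) _.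
    by apply/subsetP => s; rewrite !inE; case: (s == s0); case: (s \in B).
  by rewrite cardsU1; case: (_ \notin _); rewrite ?add1n // add0n.
by move: c1 c2 Bcard; clear; lia.
Qed.

Theorem theorem1p1 (R : realType) :
  forall (d k : nat), (0 < k)%N ->
  exists B : R,
    forall (n : nat) (V : seq 'rV[int]_n),
      full_dim R V ->
      hstar_deg_lead R V d k%:Z ->
      forall vol : R, is_norm_volume V vol -> vol <= B.
Proof.
move=> d k k0; pose b := (\sum_(i < d.+1) hstar_bound R d k i)%N.
exists b%:R => n V fV hV vol; apply: volume_bound => m.
(* Taking [n] differences of the Ehrhart function leaves the partial sums of [hstar], which stay
   below [b] because [hstar] vanishes beyond [d]. *)
have := @iter_bdiff_le n 0 (fun m => (ehrhart R V m)%:Z) b _ m.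
rewrite addn0 lez_nat; apply => {}m; rewrite bin0 muln1 bdiff_sum.
have hs i : bdiff (iter n bdiff (fun m => (ehrhart R V m)%:Z)) i = hstar R V i.
  by rewrite -[LHS]/(iter n.+1 bdiff _ i) iter_bdiffE.
have [_ [_ hd]] := hV.
apply: (@le_trans _ _ (\sum_(i < m.+1) ((i < d.+1)%N * hstar_bound R d k i)%N%:Z)).
  apply: ler_sum => i _; rewrite hs; case: ltnP => di; first by rewrite mul1n hstar_le.
  by rewrite hd.
rewrite -(big_morph Posz PoszD (erefl _)) lez_nat.
rewrite -(big_mkord xpredT (fun i => (i < d.+1)%N * hstar_bound R d k i)%N).
rewrite /b -(big_mkord xpredT) (big_nat_widen 0 m.+1 (m.+1 + d.+1)) ?leq_addr //.
rewrite (big_nat_widen 0 d.+1 (m.+1 + d.+1)) ?leq_addl //=.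
rewrite big_mkcond [leqRHS]big_mkcond; apply: leq_sum => i _.
by case: (i < m.+1)%N; case: (i < d.+1)%N; rewrite ?mul1n ?mul0n.
Qed.
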